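(* Let $X$ be a separable symmetric space on $[0,1]$ and let $f\in X$ satisfy $\int_0^1f(t)\,dt\ne0$. The following are equivalent: (i) $f\in\mathscr{M}(X)$; (ii) there is a constant $C>0$ such that for every $k_0\ge0$ the system $\{V^\alpha f\}_{|\alpha|\ge k_0}$ is an absolutely representing system in $X$ with constant $C$, i.e. for every $x\in X$ there exist real coefficients $\{\xi_\alpha\}_{|\alpha|\ge k_0}$ with $$x=\sum_{k=k_0}^{\infty}\sum_{|\alpha|=k}\xi_\alpha V^\alpha f\ \ (\text{convergence in }X)\quad\text{and}\quad \sum_{k=k_0}^\infty\Bigl\|\sum_{|\alpha|=k}\xi_\alpha V^\alpha f\Bigr\|_X\le C\|x\|_X.$$
   Context: A symmetric space $X$ on $[0,1]$ is a Banach space of (equivalence classes of) real-valued Lebesgue measurable functions on $[0,1]$ such that: (a) if $y\in X$ and $x$ is measurable with $|x|\le|y|$ a.e., then $x\in X$ and $\|x\|_X\le\|y\|_X$; (b) if $x,y$ are equimeasurable and $y\in X$, then $x\in X$ and $\|x\|_X=\|y\|_X$; normalized so that $\|\chi_{[0,1]}\|_X=1$. For $f\in L_1[0,1]$: $V_0f(t)=f(2t)$ on $[0,\frac12]$, $0$ on $(\frac12,1]$; $V_1f(t)=0$ on $[0,\frac12)$, $f(2t-1)$ on $[\frac12,1]$. For $\alpha=(\alpha_1,\dots,\alpha_k)\in\{0,1\}^k$, $|\alpha|=k$ and $V^\alpha f=V_{\alpha_1}\cdots V_{\alpha_k}f$ (identity for $k=0$), i.e. $V^\alpha f(t)=f(2^kt-i)$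 on $[i2^{-k},(i+1)2^{-k}]$, $0$ elsewhere, $i=\sum\alpha_\nu2^{k-\nu}$. Multiplicator space: $X(I\times I)$ consists of measurable $x$ on $[0,1]^2$ whose decreasing rearrangement w.r.t. planar Lebesgue measure lies in $X$, normed by the $X$-norm of that rearrangement; $\mathscr{M}(X)$ is the set of measurable $x$ on $[0,1]$ such that $y\mapsto x\otimes y$, $(x\otimes y)(s,t)=x(s)y(t)$, is bounded from $X$ into $X(I\times I)$, normed by the operator norm. *)

(* Defs.v *)
(* Functions on [0,1] are modelled as R -> R (values
   outside [0,1] are irrelevant); equivalence classes are handled by the
   axioms of a symmetric space (a.e.-equal functions have equal norms). *)
From HB Require Import structures.
From mathcomp Require Import all_boot all_order all_algebra.
From mathcomp Require Import all_classical all_reals all_analysis.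
Set Implicit Arguments. Unset Strict Implicit. Unset Printing Implicit Defensive.
Import Order.TTheory GRing.Theory Num.Theory.
Import numFieldNormedType.Exports.
Local Open Scope classical_set_scope.
Local Open Scope ring_scope.

Section Defs.
Variable R : realType.

Definition I01 : set R := `[0, 1]%classic.

Definition distr1 (x : R -> R) (s : R) : \bar R :=
  lebesgue_measure [set t | I01 t /\ s < x t].

Definition equimeasurable (x y : R -> R) : Prop :=
  forall s : R, distr1 x s = distr1 y s.

Definition chi01 : R -> R := fun t => if (0 <= t <= 1) then 1 else 0.

Record symspace := SymSpace {
  ss_mem : (R -> R) -> Prop;
  ss_norm : (R -> R) -> R;
  ss_meas : forall x, ss_mem x -> measurable_fun I01 x;
  ss_mem0 : ss_mem (fun _ => 0);
  ss_memD : forall x y, ss_mem x -> ss_mem y -> ss_mem (x \+ y);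
  ss_memZ : forall (c : R) x, ss_mem x -> ss_mem (fun t => c * x t);
  ss_norm_ge0 : forall x, ss_mem x -> 0 <= ss_norm x;
  ss_normD : forall x y, ss_mem x -> ss_mem y ->
      ss_norm (x \+ y) <= ss_norm x + ss_norm y;
  ss_normZ : forall (c : R) x, ss_mem x -> ss_norm (fun t => c * x t) = `|c| * ss_norm x;
  ss_norm_eq0 : forall x, ss_mem x ->
      (ss_norm x = 0 <-> {ae lebesgue_measure, forall t, I01 t -> x t = 0});
  ss_complete : forall u : nat -> R -> R, (forall n, ss_mem (u n)) ->
      (forall e : R, 0 < e -> exists N, forall m n, (N <= m)%N -> (N <= n)%N ->
          ss_norm (u m \- u n) < e) ->
      exists x, ss_mem x /\
        (fun n => ss_norm (x \- u n)) @ \oo --> (0 : R);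
  ss_ideal : forall x y : R -> R, ss_mem y -> measurable_fun I01 x ->
      {ae lebesgue_measure, forall t, I01 t -> `|x t| <= `|y t|} ->
      ss_mem x /\ ss_norm x <= ss_norm y;
  ss_sym : forall x y : R -> R, ss_mem y -> measurable_fun I01 x -> equimeasurable x y ->
      ss_mem x /\ ss_norm x = ss_norm y;
  ss_mem1 : ss_mem chi01;
  ss_norm1 : ss_norm chi01 = 1
}.

Definition separable (X : symspace) : Prop :=
  exists d : nat -> R -> R, (forall n, ss_mem X (d n)) /\
    forall x, ss_mem X x -> forall e : R, 0 < e ->
      exists n, ss_norm X (x \- d n) < e.

Definition I2 : set (R * R) := [set p | I01 p.1 /\ I01 p.2].

Definition distr2 (x : R * R -> R) (s : R) : \bar R :=
  ((@lebesgue_measure R) \x (@lebesgue_measure R))%E [set p | I2 p /\ s < `|x p|].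

Definition rearr2 (x : R * R -> R) : R -> R :=
  fun t => inf [set s : R | 0 <= s /\ (distr2 x s <= t%:E)%E].

Definition tensor (x y : R -> R) : R * R -> R := fun p => x p.1 * y p.2.

Definition multiplicator (X : symspace) (x : R -> R) : Prop :=
  measurable_fun I01 x /\
  exists C : R, forall y, ss_mem X y ->
    measurable_fun I2 (tensor x y) /\
    ss_mem X (rearr2 (tensor x y)) /\
    ss_norm X (rearr2 (tensor x y)) <= C * ss_norm X y.

Definition V0 (f : R -> R) : R -> R :=
  fun t => if (0 <= t <= 2^-1) then f (2 * t) else 0.
Definition V1 (f : R -> R) : R -> R :=
  fun t => if (2^-1 <= t <= 1) then f (2 * t - 1) else 0.
Definition Vb (b : bool) : (R -> R) -> R -> R := if b then V1 else V0.

Definition Valpha (a : seq bool) (f : R -> R) : R -> R := foldr Vb f a.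

Definition block (f : R -> R) (xi : forall k : nat, k.-tuple bool -> R) (k : nat)
  : R -> R := fun t => \sum_(a : k.-tuple bool) xi k a * Valpha a f t.

Definition partial_sum (f : R -> R) (xi : forall k : nat, k.-tuple bool -> R)
  (k0 N : nat) : R -> R := fun t => \sum_(k0 <= k < N) block f xi k t.

Definition abs_repr_system (X : symspace) (f : R -> R) (k0 : nat) (C : R) : Prop :=
  forall x, ss_mem X x ->
    exists xi : forall k : nat, k.-tuple bool -> R,
      ((fun N : nat => ss_norm X (x \- partial_sum f xi k0 N)) @ \oo --> (0 : R)) /\
      (forall N : nat, \sum_(k0 <= k < N) ss_norm X (block f xi k) <= C * ss_norm X x).

End Defs.
Arguments I01 {R}.
Arguments I2 {R}.
Arguments chi01 {R}.

(* Main.v *)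
(* Write [f_k t = f (2^k t mod 1)], so that a block of level [k] is [y * f_k] for
   the dyadic step function [y] of level [k] with the same coefficients, and is
   equimeasurable with [f] tensor [y].  Both conditions are equivalent to

     (M)  |y * f_k| <= C |y|  for all [k] and all dyadic step functions [y] of level [k].

   (i) <-> (M): for the converse, the rearrangement of an arbitrary [y] is
   dominated by a staircase that is constant on each [(2^-(j+1), 2^-j)] and whose
   norm is at most [2 |y|]; pasting scaled copies of [f] on these intervals gives
   a function of [X] whose distribution dominates that of [f] tensor [y].

   (M) -> (ii): separability makes the norm absolutely continuous, so dyadic step
   functions are dense, and by a law of large numbers the averages of
   [y * f_(k_1)], ..., [y * f_(k_n)] approach [y * (int f)] for sparse levels
   [k_j].  This approximates [y] by blocks of arbitrarily high level at a cost
   controlled by (M); iterating on the residual gives the expansion.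

   (ii) -> (M): expand a step function [y] of level [m] in blocks of levels
   [k >= m], with coefficients [y_k].  Averaging over the intervals of level [m]
   gives [y = (int f) * sum_k E_m y_k], and since [E_m] is an average of
   rearrangements, [E_m y_k * f_m] has norm at most that of the block
   [y_k * f_k]. *)
Require Import Defs.
From mathcomp Require Import all_boot all_order all_algebra.
From mathcomp Require Import all_classical all_reals all_analysis.
From mathcomp Require Import measurable_realfun.
From mathcomp Require Import ring lra.
Set Implicit Arguments. Unset Strict Implicit. Unset Printing Implicit Defensive.
Import Order.TTheory GRing.Theory Num.Theory.
Import numFieldNormedType.Exports.
Local Open Scope classical_set_scope.
Local Open Scope ring_scope.

(** * Laws of functions on the unit interval and juxtaposition of two functions *)

Section UnitInterval.
Variable R : realType.
Local Notation mu := (@lebesgue_measure R).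
Implicit Types (x y u v f g : R -> R) (A B : set R) (s t : R).

(** All dyadic objects come from one operation, the juxtaposition [join u v] of two half-size
    copies. Blocks, staircases and tensor products with step functions all obey recursions over
    [join], and the law of [join u v] is the mean of the laws of [u] and [v]. Equimeasurability and
    norm estimates thus become inductions without dyadic indices, valid up to null sets because the
    two halves overlap at [1/2].

    Two points shape the analysis. The integral is not controlled by the norm from the outset:
    averaging over exchanges of neighbouring intervals bounds it on step functions, and
    approximation in measure extends the bound. Also, the law of large numbers gives convergence in
    measure only. It becomes convergence in norm because [f] is first replaced by a step function
    [g], so that the averages are uniformly bounded and characteristic functions of small sets have
    small norm; the remainder [f - g] needs no averaging, only the bound [sup |y|] times its norm.

    In the expansion the tolerance for the residual is halved at each stage, so the costs form a
    geometric series; this produces the constant [4 C / |int f|]. *)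

Lemma measurable_I01 : measurable (I01 : set R).
Proof. exact: measurable_itv. Qed.
Local Hint Resolve measurable_I01 : core.

Lemma mu_I01 : mu I01 = 1%E.
Proof. by rewrite /I01 lebesgue_measure_itv /= lte01 sube0. Qed.

Lemma measurable_affine (b : R) : measurable_fun setT (fun t : R => 2 * t - b).
Proof. by apply: measurable_funB => //; apply: mulrl_measurable. Qed.

(** Twice the image of Lebesgue measure under [t -> 2 * t - b] agrees with Lebesgue measure on the
    intervals []p, q]], so uniqueness applies. *)
Lemma mu_affine (b : R) A : measurable A ->
  mu ((fun t => 2 * t - b) @^-1` A) = ((2^-1)%:E * mu A)%E.
Proof.
move=> mA.
have mh := measurable_affine b.
pose h := (fun t : measurableTypeR R => (2 * t - b : measurableTypeR R)).
pose m : {measure set (measurableTypeR R) -> \bar R} := mscale (NngNum (ler0n R 2)) (pushforward mu h).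
have E : mu A = m mh A.
  apply: (@lebesgue_measure_unique _ (m mh)) => // _ [[p q]] _ <-.
  rewrite -[RHS]/(2%:E * mu (h @^-1` `]p, q]))%E.
  have -> : h @^-1` `]p, q] = `](p + b) / 2, (q + b) / 2]%classic.
    apply/seteqP; split => t; rewrite /h /= !in_itv /= => /andP[? ?]; apply/andP; split; lra.
  rewrite !lebesgue_measure_itv /= !lte_fin.
  have -> : ((p + b) / 2 < (q + b) / 2) = (p < q) by apply/idP/idP => ?; lra.
  case: ifP => _; last by rewrite mule0.
  by rewrite -!EFinB -EFinM; congr EFin; lra.
rewrite E -[m mh A]/(2%:E * mu (h @^-1` A))%E muleA -EFinM.
by rewrite mulVf ?mul1e.
Qed.

Lemma ae_imp (P Q : R -> Prop) : (forall t, P t -> Q t) ->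
  {ae mu, forall t, P t} -> {ae mu, forall t, Q t}.
Proof. by move=> PQ; apply: (@filterS _ _ (ae_filter_ringOfSetsType mu)). Qed.

Lemma ae_imp2 (P Q S : R -> Prop) : (forall t, P t -> Q t -> S t) ->
  {ae mu, forall t, P t} -> {ae mu, forall t, Q t} -> {ae mu, forall t, S t}.
Proof. by move=> PQ; apply: (@filterS2 _ _ (ae_filter_ringOfSetsType mu)). Qed.

Lemma ae_imp3 (P Q S T : R -> Prop) : (forall t, P t -> Q t -> S t -> T t) ->
  {ae mu, forall t, P t} -> {ae mu, forall t, Q t} -> {ae mu, forall t, S t} ->
  {ae mu, forall t, T t}.
Proof. by move=> PQ; apply: (@filterS3 _ _ (ae_filter_ringOfSetsType mu)). Qed.

(** Arbitrary sets [B] cover at once the half-lines of [distr1 x] and the symmetric sets that give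
    the distribution of [|x|]. *)
Definition law x B := mu (I01 `&` x @^-1` B).

Lemma law_distr1 x s : distr1 x s = law x `]s, +oo[.
Proof.
rewrite /distr1 /law; congr (mu _); apply/seteqP.
by split => t /=; rewrite in_itv /= andbT.
Qed.

Lemma distr1_abs x s : distr1 (fun t => `|x t|) s = law x [set r | s < `|r|].
Proof. by []. Qed.

Lemma measurable_abs_gt s : measurable [set r : R | s < `|r|].
Proof.
have := @normr_measurable R setT measurableT _ (measurable_itv `]s, +oo[).
rewrite setTI; congr (measurable _); apply/seteqP.
by split => t /=; rewrite in_itv /= andbT.
Qed.

Lemma law_ge0 x B : (0 <= law x B)%E. Proof. exact: measure_ge0. Qed.

Lemma law_le1 x B : measurable_fun I01 x -> measurable B -> (law x B <= 1)%E.
Proof.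
move=> mx mB; rewrite -mu_I01; apply: le_measure; rewrite ?inE //.
exact: mx.
Qed.

Definition aeq x y := {ae mu, forall t, I01 t -> x t = y t}.

Lemma aeq_refl x : aeq x x.
Proof. exact: aeW. Qed.

Lemma aeq_sym x y : aeq x y -> aeq y x.
Proof. by apply: ae_imp => t xy It; rewrite xy. Qed.

Lemma aeq_trans y x z : aeq x y -> aeq y z -> aeq x z.
Proof. by apply: ae_imp2 => t xy yz It; rewrite xy // yz. Qed.

Lemma ae_ne a : {ae mu, forall t, t != a}.
Proof.
exists [set a]; split => //; first exact: lebesgue_measure_set1.
by move=> t /= /negP; rewrite negbK => /eqP.
Qed.

Lemma ae_measure_eq A B : measurable A -> measurable B ->
  {ae mu, forall t, A t <-> B t} -> mu A = mu B.
Proof.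
move=> mA mB [N [mN N0 sN]].
have E (C D : set R) : measurable C -> measurable D ->
    (~` [set t | C t <-> D t] `<=` N) -> (mu C <= mu D)%E.
  move=> mC mD s; rewrite -(@measureU0 _ _ _ mu _ _ mD mN N0).
  apply: le_measure; rewrite ?inE //; first exact: measurableU.
  by move=> t Ct; have [Dt|nDt] := pselect (D t); [left|right; apply: s => /= -[h _]; apply: nDt; exact: h].
apply/eqP; rewrite eq_le !E // => t /= h; apply: sN => /= -[h1 h2]; apply: h; split => //.
Qed.

Lemma aeq_law x y B : measurable_fun I01 x -> measurable_fun I01 y -> measurable B ->
  aeq x y -> law x B = law y B.
Proof.
move=> mx my mB xy; apply: ae_measure_eq; [exact: mx|exact: my|].
by apply: ae_imp _ xy => t xy; split => -[It h]; split=> //; move: h; rewrite /preimage /= xy.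
Qed.

Lemma measurable_piece (a1 a2 b : R) u : measurable_fun I01 u ->
  (forall t, a1 <= t <= a2 -> 0 <= 2 * t - b <= 1) ->
  measurable_fun setT (fun t => if a1 <= t <= a2 then u (2 * t - b) else 0).
Proof.
move=> mu_ h.
have -> : (fun t => if a1 <= t <= a2 then u (2 * t - b) else 0) =
    (fun t => u (2 * t - b)) \_ `[a1, a2]%classic.
  by apply/funext => t; rewrite patchE mem_setE in_itv.
have mab : measurable (`[a1, a2]%classic : set R) by exact: measurable_itv.
apply: (measurable_restrictT (fun t => u (2 * t - b)) mab).1.
have s : (fun t => 2 * t - b) @` `[a1, a2] `<=` I01.
  by move=> _ [t /= + <-]; rewrite in_itv /= => /h; rewrite /I01 /= in_itv.
have m2 : measurable_fun `[a1, a2] (fun t => 2 * t - b).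
  exact: measurable_funTS (measurable_affine b).
exact: measurable_comp measurable_I01 s mu_ m2.
Qed.

Lemma measurable_V0 u : measurable_fun I01 u -> measurable_fun I01 (V0 u).
Proof.
move=> mu_; apply: measurable_funTS; rewrite /V0.
under eq_fun do rewrite -[2 * _]subr0.
by apply: measurable_piece => // t /andP[? ?]; apply/andP; split; lra.
Qed.

Lemma measurable_V1 u : measurable_fun I01 u -> measurable_fun I01 (V1 u).
Proof.
move=> mu_; apply: measurable_funTS; rewrite /V1.
by apply: measurable_piece => // t /andP[? ?]; apply/andP; split; lra.
Qed.

(** At [t = 1/2] both summands may be nonzero and add up; statements about [join] are therefore made
    almost everywhere. *)
Definition join u v : R -> R := V0 u \+ V1 v.

Lemma measurable_join u v : measurable_fun I01 u -> measurable_fun I01 v ->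
  measurable_fun I01 (join u v).
Proof. by move=> ? ?; apply: measurable_funD; [exact: measurable_V0|exact: measurable_V1]. Qed.

Lemma joinl u v t : 0 <= t < 2^-1 -> join u v t = u (2 * t).
Proof.
move=> /andP[t0 t1]; rewrite /join /V0 /V1 /= t0 (ltW t1) /=.
by rewrite leNgt t1 /= addr0.
Qed.

Lemma joinr u v t : 2^-1 < t <= 1 -> join u v t = v (2 * t - 1).
Proof.
move=> /andP[t0 t1]; rewrite /join /V0 /V1 /= t1 (ltW t0) /=.
by rewrite (leNgt t) t0 andbF add0r.
Qed.

(** Each half is an affine preimage, which contributes the factor [1/2] by [mu_affine]. Replacing
    the unit interval by []0, 1[] makes the two preimages disjoint and costs only the points 0, 1/2
    and 1. *)
Lemma law_join u v B : measurable_fun I01 u -> measurable_fun I01 v -> measurable B ->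
  law (join u v) B = ((2^-1)%:E * (law u B + law v B))%E.
Proof.
move=> mu_ mv mB.
have mo : measurable (`]0:R, 1[%classic : set R) by exact: measurable_itv.
have so : `]0:R, 1[%classic `<=` (I01 : set R).
  by move=> t /=; rewrite /I01 /= !in_itv /= => /andP[? ?]; apply/andP; split; apply: ltW.
have mO w : measurable_fun I01 w -> measurable (`]0:R, 1[%classic `&` w @^-1` B).
  by move=> mw; exact: (measurable_funS _ so mw).
have lawO w : measurable_fun I01 w -> law w B = mu (`]0:R, 1[%classic `&` w @^-1` B).
  move=> mw; apply: ae_measure_eq; [exact: mw|exact: mO|].
  apply: ae_imp2 _ (ae_ne 0) (ae_ne 1) => t t0 t1; split => -[It h]; split => //.
    by move: It; rewrite /I01 /= !in_itv /= !lt_def => /andP[-> ->]; rewrite t0 eq_sym t1.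
  exact: so.
have mpre (b : R) A : measurable A -> measurable ((fun t => 2 * t - b) @^-1` A).
  by move=> mA; have := measurable_affine b measurableT mA; rewrite setTI.
rewrite ge0_muleDr ?law_ge0 // (lawO u) // (lawO v) //.
rewrite -(mu_affine 0 (mO u mu_)) -(mu_affine 1 (mO v mv)).
have m0 := mpre 0 _ (mO u mu_); have m1 := mpre 1 _ (mO v mv).
rewrite -(@measureU _ _ _ mu _ _ m0 m1); last first.
  apply/seteqP; split => // t /=; rewrite !in_itv /= => -[[/andP[? ?] _] [/andP[? ?] _]].
  by exfalso; lra.
apply: ae_measure_eq; first exact: measurable_join.
- exact: measurableU m0 m1.
apply: ae_imp3 _ (ae_ne 0) (ae_ne 1) (ae_ne 2^-1) => t t0 t1 t2; split.
- rewrite /I01 /= !in_itv /= => -[/andP[h0 h1] h].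
  have [lt|gt|/eqP] := ltgtP t 2^-1; last by rewrite (negPf t2).
    left; rewrite joinl ?h0 // in h; rewrite subr0; split => //.
    have : 0 < t by rewrite lt_def t0. 
    by move=> ?; apply/andP; split; lra.
  right; rewrite joinr ?h1 ?gt // in h; split => //.
  have : t < 1 by rewrite lt_def eq_sym t1. 
  by move=> ?; apply/andP; split; lra.
- rewrite /I01 /= !in_itv /= subr0 => -[[/andP[? ?] h]|[/andP[? ?] h]].
    split; first by apply/andP; split; lra.
    by rewrite joinl //; apply/andP; split; lra.
  split; first by apply/andP; split; lra.
  by rewrite joinr //; apply/andP; split; lra.
Qed.

End UnitInterval.
#[global] Hint Resolve measurable_I01 : core.

(** * Dyadic trees of functions and equality of laws *)

Section Trees.
Variable R : realType.
Local Notation mu := (@lebesgue_measure R).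
Implicit Types (x y f g : R -> R) (A B : set R) (s t : R) (k m : nat).
Implicit Types (u v w : seq bool -> R -> R) (xi : seq bool -> R).

Lemma ae_affine (b : R) (P : R -> Prop) : {ae mu, forall t, P t} ->
  {ae mu, forall t, P (2 * t - b)}.
Proof.
move=> [N [mN N0 sN]]; exists ((fun t => 2 * t - b) @^-1` N); split.
- by have := measurable_affine b measurableT mN; rewrite setTI.
- by have := mu_affine b mN; rewrite N0 mule0.
- by move=> t; apply: sN.
Qed.

(** The relation [P] is arbitrary so that equalities, bounds and inequalities between absolute
    values pass to trees by one induction. *)
Lemma join_rel2 (P : R -> R -> Prop) (u1 u2 v1 v2 : R -> R) :
  {ae mu, forall t, I01 t -> P (u1 t) (u2 t)} ->
  {ae mu, forall t, I01 t -> P (v1 t) (v2 t)} ->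
  {ae mu, forall t, I01 t -> P (join u1 v1 t) (join u2 v2 t)}.
Proof.
move=> /(ae_affine 0) hu /(ae_affine 1) hv.
apply: ae_imp3 _ hu hv (ae_ne 2^-1) => t hu hv t2.
rewrite subr0 /I01 /= !in_itv /= in hu hv * => /andP[t0 t1].
have [lt|gt|/eqP] := ltgtP t 2^-1; last by rewrite (negPf t2).
  rewrite !joinl ?t0 //; apply: hu; apply/andP; split; lra.
rewrite !joinr ?t1 ?gt //; apply: hv; apply/andP; split; lra.
Qed.

(** Places a compressed copy of [u a] on the dyadic interval whose binary address is [a], most
    significant digit first. *)
Fixpoint tree u k : R -> R :=
  if k is k'.+1 then
    join (tree (fun a => u (false :: a)) k') (tree (fun a => u (true :: a)) k')
  else u [::].

(** Coefficients are indexed by all words, though only those of length [k] matter, so that a change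
    of level needs no casts between tuple types. [blk chi01 xi k] is the dyadic step function with
    these coefficients. *)
Definition blk f xi k := tree (fun a t => xi a * f t) k.

Lemma blkS f xi k : blk f xi k.+1 =
  join (blk f (fun a => xi (false :: a)) k) (blk f (fun a => xi (true :: a)) k).
Proof. by []. Qed.

Lemma eq_tree u v k : (forall a, size a = k -> u a = v a) -> tree u k = tree v k.
Proof.
elim: k u v => [|k IH] u v uv /=; first exact: uv.
by congr join; apply: IH => a ak; apply: uv; rewrite /= ak.
Qed.

Lemma eq_blk f xi xi' k : (forall a, size a = k -> xi a = xi' a) ->
  blk f xi k = blk f xi' k.
Proof. by move=> h; apply: eq_tree => a /h ->. Qed.

Lemma join_lin c (x1 y1 x2 y2 : R -> R) :
  join (fun t => c * x1 t + y1 t) (fun t => c * x2 t + y2 t) =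
  (fun t => c * join x1 x2 t + join y1 y2 t).
Proof.
apply/funext => t; rewrite /join /V0 /V1 /=.
by case: ifP => _; case: ifP => _; ring.
Qed.

Lemma tree_lin c u v k : tree (fun a t => c * u a t + v a t) k =
  (fun t => c * tree u k t + tree v k t).
Proof. by elim: k u v => [//|k IH] u v /=; rewrite !IH join_lin. Qed.

Lemma blk_lin f c xi xi' k : blk f (fun a => c * xi a + xi' a) k =
  (fun t => c * blk f xi k t + blk f xi' k t).
Proof.
rewrite /blk -tree_lin; apply: eq_tree => a _; apply/funext => t; ring.
Qed.

Lemma blkZ f c xi k : blk f (fun a => c * xi a) k = (fun t => c * blk f xi k t).
Proof.
rewrite /blk; elim: k xi => [|k IH] xi /=; first by apply/funext => t; rewrite mulrA.
rewrite !IH; apply/funext => t; rewrite /join /V0 /V1 /=.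
by case: ifP => _; case: ifP => _; ring.
Qed.

Lemma tree_rel2 (P : R -> R -> Prop) u v k :
  (forall a, size a = k -> {ae mu, forall t, I01 t -> P (u a t) (v a t)}) ->
  {ae mu, forall t, I01 t -> P (tree u k t) (tree v k t)}.
Proof.
elim: k u v => [|k IH] u v h /=; first exact: h.
by apply: join_rel2; apply: IH => a ak; apply: h; rewrite /= ak.
Qed.

Lemma tree_rel1 (P : R -> Prop) u k :
  (forall a, size a = k -> {ae mu, forall t, I01 t -> P (u a t)}) ->
  {ae mu, forall t, I01 t -> P (tree u k t)}.
Proof. exact: (@tree_rel2 (fun r _ => P r) u u). Qed.

Lemma tree_cat u k m : tree u (k + m) = tree (fun a => tree (fun b => u (a ++ b)) m) k.
Proof. by elim: k u => [//|k IH] u; rewrite addSn /= !IH. Qed.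

Lemma tree_rcons u k : tree u k.+1 =
  tree (fun a => join (u (rcons a false)) (u (rcons a true))) k.
Proof.
rewrite -addn1 tree_cat; apply: eq_tree => a _ /=.
by rewrite !cats1.
Qed.

Lemma measurable_tree u k : (forall a, measurable_fun I01 (u a)) ->
  measurable_fun I01 (tree u k).
Proof.
elim: k u => [|k IH] u h /=; first exact: h.
by apply: measurable_join; apply: IH.
Qed.

Lemma measurable_scale c f : measurable_fun I01 f -> measurable_fun I01 (fun t => c * f t).
Proof. by move=> mf; apply: (@measurable_funM _ _ R _ (cst c) f) => //; exact: measurable_cst. Qed.

Lemma measurable_blk f xi k : measurable_fun I01 f -> measurable_fun I01 (blk f xi k).
Proof. by move=> mf; apply: measurable_tree => a; exact: (measurable_scale (xi a) mf). Qed.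

(** Quantifying over all measurable sets rather than half-lines lets the same relation compare the
    level sets of absolute values. *)
Definition equi x y := forall B, measurable B -> law x B = law y B.

Lemma equi_sym x y : equi x y -> equi y x. Proof. by move=> h B /h. Qed.

Lemma equi_trans y x z : equi x y -> equi y z -> equi x z.
Proof. by move=> h h' B mB; rewrite h // h'. Qed.

Lemma equi_distr x y : equi x y -> equimeasurable x y.
Proof. by move=> h s; rewrite !law_distr1; apply: h; exact: measurable_itv. Qed.

Lemma aeq_equi x y : measurable_fun I01 x -> measurable_fun I01 y -> aeq x y -> equi x y.
Proof. by move=> mx my h B mB; exact: aeq_law. Qed.

Lemma equi_tree u v k : (forall a, measurable_fun I01 (u a)) ->
  (forall a, measurable_fun I01 (v a)) ->
  (forall a, size a = k -> equi (u a) (v a)) -> equi (tree u k) (tree v k).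
Proof.
elim: k u v => [|k IH] u v hu hv h /=; first exact: h.
move=> B mB; rewrite !law_join //; try by apply: measurable_tree => a.
by congr (_ * (_ + _))%E; apply: IH => // a ak; apply: h; rewrite /= ak.
Qed.

Lemma equi_swap x y : measurable_fun I01 x -> measurable_fun I01 y ->
  equi (join x y) (join y x).
Proof. by move=> mx my B mB; rewrite !law_join // addeC. Qed.

Lemma law_fin x B : measurable_fun I01 x -> measurable B -> law x B \is a fin_num.
Proof.
move=> mx mB; rewrite ge0_fin_numE ?law_ge0 //.
by apply: le_lt_trans (law_le1 mx mB) _; rewrite ltey.
Qed.

Lemma equi_dup x : measurable_fun I01 x -> equi (join x x) x.
Proof.
move=> mx B mB; rewrite law_join //; have := law_fin mx mB.
case: (law x B) => [r| |] // _; rewrite -EFinD -EFinM; congr EFin; lra.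
Qed.

Lemma equi_tree_const x k : measurable_fun I01 x -> equi (tree (fun=> x) k) x.
Proof.
move=> mx; elim: k => [//|k IH] /=.
apply: equi_trans IH; apply: equi_dup; exact: measurable_tree.
Qed.

(** Splitting off the first letter turns the sum over tuples of length [k.+1] into the two halves of
    a [join]. *)
Lemma blockE f (xi : forall k, k.-tuple bool -> R) (xi' : seq bool -> R) k :
  (forall a : k.-tuple bool, xi k a = xi' a) -> block f xi k = blk f xi' k.
Proof.
move=> h; rewrite /block; apply/funext => t.
under eq_bigr do rewrite h.
elim: k xi' t {xi h} => [|k IH] xi t.
  rewrite (eq_bigl (pred1 [tuple])) ?big_pred1_eq // => a /=.
  by rewrite tuple0; apply/esym/eqP.
rewrite (reindex (fun p : bool * k.-tuple bool => [tuple of p.1 :: p.2])) /=; last first.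
  exists (fun a => (thead a, [tuple of behead a])) => [[b a] _|a _] /=.
    by congr pair; apply: val_inj.
  by rewrite -tuple_eta.
rewrite -(pair_bigA _ (fun b (a : k.-tuple bool) => xi (b :: a) * Vb b (Valpha a f) t)) /=.
rewrite big_bool /= addrC blkS /join /V0 /V1 /=; congr (_ + _).
  by case: ifP => _; [rewrite -IH|rewrite big1 // => a _; rewrite mulr0].
by case: ifP => _; [rewrite -IH|rewrite big1 // => a _; rewrite mulr0].
Qed.

End Trees.

(** * Norm inequalities from symmetry and averaging *)

Section NormSpace.
Variables (R : realType) (X : symspace R).
Local Notation mu := (@lebesgue_measure R).
Local Notation mem := (ss_mem X).
Local Notation N := (ss_norm X).
Implicit Types (x y f g : R -> R) (A B : set R) (c e r s t : R) (k m n : nat).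
Implicit Types (u v w : seq bool -> R -> R) (xi : seq bool -> R).

Lemma mem_dom x y : mem y -> measurable_fun I01 x ->
  {ae mu, forall t, I01 t -> `|x t| <= `|y t|} -> mem x.
Proof. by move=> my mx h; have [] := ss_ideal my mx h. Qed.

Lemma norm_dom x y : mem y -> measurable_fun I01 x ->
  {ae mu, forall t, I01 t -> `|x t| <= `|y t|} -> N x <= N y.
Proof. by move=> my mx h; have [] := ss_ideal my mx h. Qed.

Lemma aeq_le x y : aeq x y -> {ae mu, forall t, I01 t -> `|x t| <= `|y t|}.
Proof. by apply: ae_imp => t h It; rewrite h. Qed.

Lemma norm_aeq x y : mem x -> mem y -> aeq x y -> N x = N y.
Proof.
move=> mx my xy; apply/eqP; rewrite eq_le; apply/andP; split; apply: norm_dom => //.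
- exact: ss_meas mx.
- exact: aeq_le.
- exact: ss_meas my.
- exact/aeq_le/aeq_sym.
Qed.

Lemma mem_equi x y : mem y -> measurable_fun I01 x -> equi x y -> mem x.
Proof. by move=> my mx /equi_distr h; have [] := ss_sym my mx h. Qed.

Lemma norm_equi x y : mem y -> measurable_fun I01 x -> equi x y -> N x = N y.
Proof. by move=> my mx /equi_distr h; have [] := ss_sym my mx h. Qed.

Lemma measurable_mem x : mem x -> measurable_fun I01 x.
Proof. exact: ss_meas. Qed.
Local Hint Resolve measurable_mem : core.

Lemma memB x y : mem x -> mem y -> mem (x \- y).
Proof.
move=> mx my; have := ss_memD mx (ss_memZ (-1) my); congr mem.
by apply/funext => t /=; rewrite mulN1r.
Qed.

Lemma norm_subC x y : mem x -> mem y -> N (x \- y) = N (y \- x).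
Proof.
move=> mx my; have := ss_normZ (-1) (memB mx my); rewrite normrN1 mul1r => <-.
by congr N; apply/funext => t /=; rewrite mulN1r opprB.
Qed.

Lemma norm_tri z x y : mem x -> mem y -> mem z -> N (x \- y) <= N (x \- z) + N (z \- y).
Proof.
move=> mx my mz; apply: le_trans (ss_normD (memB mx mz) (memB mz my)).
by rewrite le_eqVlt; apply/orP; left; apply/eqP; congr N; apply/funext => t /=; ring.
Qed.

Lemma norm_triD x y : mem x -> mem y -> N x <= N y + N (x \- y).
Proof.
move=> mx my; apply: le_trans (ss_normD my (memB mx my)).
by rewrite le_eqVlt; apply/orP; left; apply/eqP; congr N; apply/funext => t /=; ring.
Qed.

Lemma norm0 : N (fun=> 0) = 0.
Proof.
by have := ss_normZ 0 (ss_mem0 X); rewrite normr0 !mul0r.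
Qed.

(** Gives [V0 x] and [V1 x] a majorant equimeasurable with [x], so that the ideal property puts both
    into the space. *)
Lemma V_le_join x : {ae mu, forall t, I01 t ->
  `|V0 x t| <= `|join x x t| /\ `|V1 x t| <= `|join x x t|}.
Proof.
apply: ae_imp _ (ae_ne 2^-1) => t t2; rewrite /I01 /= in_itv /= => /andP[t0 t1].
rewrite /join /V0 /V1 /= t0 t1 /= andbT.
have [lt|gt|/eqP] := ltgtP t 2^-1; last by rewrite (negPf t2).
  by rewrite addr0 normr0.
by rewrite add0r normr0.
Qed.

Lemma mem_joinxx x : mem x -> mem (join x x).
Proof.
by move=> mx; apply: (mem_equi mx); [apply: measurable_join; auto|apply: equi_dup; auto].
Qed.

Lemma mem_V0 x : mem x -> mem (V0 x).
Proof.
move=> mx; apply: (mem_dom (mem_joinxx mx)); first by apply: measurable_V0; auto.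
by apply: ae_imp _ (V_le_join x) => t h /h[].
Qed.

Lemma mem_V1 x : mem x -> mem (V1 x).
Proof.
move=> mx; apply: (mem_dom (mem_joinxx mx)); first by apply: measurable_V1; auto.
by apply: ae_imp _ (V_le_join x) => t h /h[].
Qed.

(* [x] is equimeasurable with the juxtaposition of two copies of itself, each
   of which is equimeasurable with [V0 x]. *)
Lemma V0_dilation x : measurable_fun I01 x -> mem (V0 x) -> mem x /\ N x <= 2 * N (V0 x).
Proof.
move=> mx m0; have mV1 := measurable_V1 mx.
have e1 : equi (V1 x) (V0 x).
  have := equi_swap (ss_meas (ss_mem0 X)) mx.
  by congr equi; apply/funext => t; rewrite /join /V0 /V1 /= !if_same ?add0r ?addr0.
have m1 := mem_equi m0 mV1 e1; have n1 := norm_equi m0 mV1 e1.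
have mj : mem (join x x) by exact: ss_memD.
have ed := equi_sym (equi_dup mx).
split; first exact: mem_equi mj mx ed.
by rewrite (norm_equi mj mx ed); apply: le_trans (ss_normD m0 m1) _; rewrite n1; lra.
Qed.

Lemma V1_dilation x : measurable_fun I01 x -> mem (V1 x) -> mem x /\ N x <= 2 * N (V1 x).
Proof.
move=> mx m1; have mV0 := measurable_V0 mx.
have e0 : equi (V0 x) (V1 x).
  have := equi_swap mx (ss_meas (ss_mem0 X)).
  by congr equi; apply/funext => t; rewrite /join /V0 /V1 /= !if_same ?add0r ?addr0.
rewrite -(norm_equi m1 mV0 e0); apply: V0_dilation => //; exact: mem_equi m1 mV0 e0.
Qed.

Lemma mem_join x y : mem x -> mem y -> mem (join x y).
Proof. by move=> mx my; apply: ss_memD; [exact: mem_V0|exact: mem_V1]. Qed.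

Lemma mem_tree u k : (forall a, mem (u a)) -> mem (tree u k).
Proof. elim: k u => [|k IH] u h /=; [exact: h|apply: mem_join; exact: IH]. Qed.

Lemma mem_blk f xi k : mem f -> mem (blk f xi k).
Proof. by move=> mf; apply: mem_tree => a; exact: ss_memZ. Qed.

Lemma norm_tree_equi u v k : (forall a, mem (u a)) -> (forall a, mem (v a)) ->
  (forall a, size a = k -> equi (u a) (v a)) -> N (tree u k) = N (tree v k).
Proof.
move=> hu hv h; apply: norm_equi; first exact: mem_tree.
- by apply: measurable_mem; exact: mem_tree.
- by apply: equi_tree => // a; auto.
Qed.

(** The block is dominated by the one with constant coefficient [M], and that one is equimeasurable
    with [M * f]. *)
Lemma norm_blk_bounded f xi k M : mem f -> 0 <= M ->
  (forall a, size a = k -> `|xi a| <= M) -> N (blk f xi k) <= M * N f.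
Proof.
move=> mf M0 h.
have mMf : mem (fun t => M * f t) by exact: ss_memZ.
rewrite -{1}(ger0_norm M0) -(ss_normZ _ mf).
have mtr : mem (tree (fun=> (fun t => M * f t)) k) by exact: mem_tree.
rewrite -(norm_equi mMf (measurable_mem mtr)); last by apply: equi_tree_const; auto.
apply: norm_dom => //; first by apply: measurable_mem; exact: mem_blk.
apply: (@tree_rel2 _ (fun p q => `|p| <= `|q|)) => a ak; apply: aeW => t It.
by rewrite !normrM ler_wpM2r // (ger0_norm M0) h.
Qed.

(** Exchanging the two children of every interval of level [m] keeps the law of the block. The sum
    of the original [T false] and the exchanged [T true] has equal children, hence the law of a
    block of level [m]; the triangle inequality finishes. *)
Lemma norm_halve f xi m : mem f ->
  N (blk f (fun a => (xi (rcons a false) + xi (rcons a true)) / 2) m) <= N (blk f xi m.+1).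
Proof.
move=> mf.
have mZ c : mem (fun t => c * f t) by exact: ss_memZ.
pose p b a t := xi (rcons a b) * f t.
pose T b := tree (fun a => join (p b a) (p (~~ b) a)) m.
have mJ b (c : bool) a : mem (join (p b a) (p c a)) by apply: mem_join; exact: mZ.
have mT b : mem (T b) by apply: mem_tree => a; exact: mJ.
have T0 : T false = blk f xi m.+1 by rewrite /T /blk tree_rcons.
have T1 : N (T true) = N (T false).
  by apply: norm_tree_equi => // a _; apply: equi_swap; apply: measurable_mem; exact: mZ.
pose eta a := (xi (rcons a false) + xi (rcons a true)) / 2.
have S : N (T false \+ T true) = 2 * N (blk f eta m).
  rewrite -[2]ger0_norm // -(ss_normZ _ (mem_blk eta m mf)) -blkZ.
  have -> : T false \+ T true = tree (fun a => join (fun t => 2 * eta a * f t) (fun t => 2 * eta a * f t)) m.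
    apply/funext => t /=; rewrite -[T false t]mul1r /T.
    have := tree_lin 1 (fun a => join (p false a) (p true a)) (fun a => join (p true a) (p false a)) m.
    move=> /(congr1 (fun h => h t)) <-; congr (_ t); apply: eq_tree => a _.
    by rewrite -join_lin; congr join; apply/funext => s; rewrite /p /eta /=; field.
  apply: norm_tree_equi => [a|a|a _]; [exact: mem_join|exact: mZ|].
  by apply: equi_dup; apply: measurable_mem; exact: mZ.
have := ss_normD (mT false) (mT true); rewrite S T1 T0 -/eta; lra.
Qed.

(** The integral of the step function [blk chi01 xi k] in combinatorial form. *)
Fixpoint avg xi k : R :=
  if k is k'.+1 then
    (avg (fun a => xi (false :: a)) k' + avg (fun a => xi (true :: a)) k') / 2
  else xi [::].

Lemma eq_avg xi xi' k : (forall a, size a = k -> xi a = xi' a) -> avg xi k = avg xi' k.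
Proof.
elim: k xi xi' => [|k IH] xi xi' h /=; first exact: h.
by congr ((_ + _) / 2); apply: IH => a ak; apply: h; rewrite /= ak.
Qed.

Lemma avg_lin c xi xi' k : avg (fun a => c * xi a + xi' a) k = c * avg xi k + avg xi' k.
Proof. by elim: k xi xi' => [//|k IH] xi xi' /=; rewrite !IH; field. Qed.

Lemma avg_const c k : avg (fun=> c) k = c.
Proof. by elim: k => [//|k IH] /=; rewrite IH; field. Qed.

Lemma avg_cat xi k m : avg xi (k + m) = avg (fun a => avg (fun b => xi (a ++ b)) m) k.
Proof. by elim: k xi => [//|k IH] xi; rewrite addSn /= !IH. Qed.

Lemma ler_avg xi xi' k : (forall a, size a = k -> xi a <= xi' a) -> avg xi k <= avg xi' k.
Proof.
elim: k xi xi' => [|k IH] xi xi' h /=; first exact: h.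
by rewrite ler_pM2r ?invr_gt0 // lerD //; apply: IH => a ak; apply: h; rewrite /= ak.
Qed.

(** Averages out one last letter at a time. For [f = chi01] this is the contractivity of the
    conditional expectation onto the dyadic intervals of level [m]. *)
Lemma norm_avg f xi m d : mem f ->
  N (blk f (fun a => avg (fun b => xi (a ++ b)) d) m) <= N (blk f xi (m + d)).
Proof.
move=> mf; elim: d m => [|d IH] m.
  by rewrite addn0 (@eq_blk _ _ _ xi) // => a _ /=; rewrite cats0.
rewrite addnS -addSn; apply: le_trans (IH m.+1).
rewrite (@eq_blk _ _ _ (fun a => (avg (fun b => xi (rcons a false ++ b)) d
  + avg (fun b => xi (rcons a true ++ b)) d) / 2)); first exact: norm_halve.
by move=> a _ /=; congr ((_ + _) / 2); apply: eq_avg => b _; rewrite cat_rcons.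
Qed.

(** Averaging down to level 0 leaves a multiple of [chi01]. This is the germ of the bound of the
    integral by the norm. *)
Lemma abs_avg_le xi k : `|avg xi k| <= N (blk chi01 xi k).
Proof.
have := norm_avg xi 0 k (ss_mem1 X); rewrite add0n /blk /=.
by rewrite (ss_normZ _ (ss_mem1 X)) ss_norm1 mulr1.
Qed.

End NormSpace.

(** * Absolute continuity of the norm of a separable space *)

Section AbsoluteContinuity.
Variables (R : realType) (X : symspace R).
Local Notation mu := (@lebesgue_measure R).
Local Notation mem := (ss_mem X).
Local Notation N := (ss_norm X).
Implicit Types (x y f g : R -> R) (A B : set R) (c e r s t : R) (k m n : nat).

Definition cut A x : R -> R := fun t => (t \in A)%:R * x t.

Lemma cut_in A x t : A t -> cut A x t = x t.
Proof. by move=> At; rewrite /cut mem_set // mul1r. Qed.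

Lemma cut_notin A x t : ~ A t -> cut A x t = 0.
Proof. by move=> At; rewrite /cut memNset // mul0r. Qed.

Lemma abs_cut A x t : `|cut A x t| <= `|x t|.
Proof.
have [At|At] := pselect (A t); first by rewrite cut_in.
by rewrite cut_notin // normr0.
Qed.

Lemma measurable_cut A x : measurable A -> measurable_fun I01 x -> measurable_fun I01 (cut A x).
Proof.
move=> mA mx; apply: (@measurable_funM _ _ R _ (fun t => (t \in A)%:R) x) => //.
exact: measurable_indic.
Qed.

Lemma mem_cut A x : measurable A -> mem x -> mem (cut A x).
Proof.
move=> mA mx; apply: (mem_dom mx); first by apply: measurable_cut => //; exact: ss_meas mx.
by apply: aeW => t _; exact: abs_cut.
Qed.

Lemma norm_cut A x : measurable A -> mem x -> N (cut A x) <= N x.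
Proof.
move=> mA mx; apply: (norm_dom mx); first by apply: measurable_cut => //; exact: ss_meas mx.
by apply: aeW => t _; exact: abs_cut.
Qed.

Lemma cvg_norm_eps (u : nat -> R) : u @ \oo --> (0 : R) ->
  forall e, 0 < e -> exists n, forall m, (n <= m)%N -> u m < e.
Proof.
move=> /cvgrPdist_lt h e e0; have [n _ hn] := h e e0; exists n => m nm.
by have := hn m nm; rewrite sub0r normrN; apply: le_lt_trans; exact: ler_norm.
Qed.

Lemma eps_cvg_norm (u : nat -> R) : (forall n, 0 <= u n) ->
  (forall e, 0 < e -> exists n, forall m, (n <= m)%N -> u m < e) ->
  u @ \oo --> (0 : R).
Proof.
move=> u0 h; apply/cvgrPdist_lt => e e0; have [n hn] := h e e0.
by exists n => // m nm; rewrite sub0r normrN ger0_norm ?hn.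
Qed.

(* Cantor's diagonal argument: were all the pieces large, the sub-unions of
   the pieces would form an uncountable separated family. *)
Lemma disjoint_pieces_small x (B : nat -> set R) e : separable X -> mem x ->
  (forall k, measurable (B k)) -> (forall j k t, B j t -> B k t -> j = k) -> 0 < e ->
  exists k, N (cut (B k) x) < e.
Proof.
move=> [d [md dense]] mx mB dB e0; apply: contrapT => /forallNP h.
have {}h k : e <= N (cut (B k) x) by have /negP := h k; rewrite -leNgt.
(* The diagonal choice: the piece [B k] is kept exactly when [d k] is small on it, so on [B n] the
   function [d n] is far from [x] if [n] is kept and far from 0 if it is not. *)
pose S := [set k | N (cut (B k) (d k)) < e / 2].
have mU : measurable (\bigcup_(k in S) B k) by exact: bigcup_measurable.
have mUx := mem_cut mU mx.
have [n hn] := dense _ mUx (e / 2) (divr_gt0 e0 (ltr0Sn R 1)).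
have le : N (cut (B n) (cut (\bigcup_(k in S) B k) x \- d n)) < e / 2.
  by apply: le_lt_trans hn; apply: norm_cut => //; exact: memB.
have mdn := mem_cut (mB n) (md n).
have [Sn|Sn] := pselect (S n).
- have E : cut (B n) (cut (\bigcup_(k in S) B k) x \- d n) = cut (B n) x \- cut (B n) (d n).
    apply/funext => t /=; have [Bt|Bt] := pselect (B n t).
      by rewrite (cut_in _ Bt) /= !cut_in //; exists n.
    by rewrite !(cut_notin _ Bt) subr0.
  rewrite E in le; have := norm_triD (mem_cut (mB n) mx) mdn.
  by have := h n; move: Sn; rewrite /S /=; lra.
- have E : cut (B n) (cut (\bigcup_(k in S) B k) x \- d n) = (fun t => -1 * cut (B n) (d n) t).
    apply/funext => t /=; have [Bt|Bt] := pselect (B n t); last by rewrite !(cut_notin _ Bt) mulr0.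
    rewrite !(cut_in _ Bt) /= cut_notin ?mulN1r ?sub0r // => -[k Sk Bk].
    by apply: Sn; rewrite (dB _ _ _ Bt Bk).
  rewrite E ss_normZ // normrN1 mul1r in le.
  by apply: Sn.
Qed.

Lemma norm_cut_mono A B x : measurable A -> measurable B -> mem x -> A `<=` B ->
  N (cut A x) <= N (cut B x).
Proof.
move=> mA mB mx AB; have -> : cut A x = cut A (cut B x).
  apply/funext => t; have [At|At] := pselect (A t); last by rewrite !(cut_notin _ At).
  by rewrite !cut_in //; exact: AB.
by apply: norm_cut => //; exact: mem_cut.
Qed.

(** The cuts of [x] to the complements of the [A n] form a Cauchy sequence, since otherwise
    infinitely many disjoint differences would carry large pieces of [x]. Their limit agrees with
    [x] off every [A n], hence almost everywhere. *)
Lemma abs_continuity x (A : nat -> set R) : separable X -> mem x ->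
  (forall n, measurable (A n)) -> (forall n, A n.+1 `<=` A n) ->
  {ae mu, forall t, I01 t -> exists n, ~ A n t} ->
  forall e, 0 < e -> exists n, forall m, (n <= m)%N -> N (cut (A m) x) < e.
Proof.
move=> sep mx mA dA A0.
have dec m n : (m <= n)%N -> A n `<=` A m.
  by move=> /subnK <-; elim: (n - m)%N => [//|i IH] t /dA; exact: IH.
have mD m n : measurable (A m `\` A n) by exact: measurableD.
have mC n : measurable (~` A n) by exact: measurableC.
have small e : 0 < e -> exists M, forall m n, (M <= m)%N -> (m < n)%N ->
    N (cut (A m `\` A n) x) < e.
  move=> e0; apply: contrapT => /forallNP h.
  have {h} h M : exists p : nat * nat, [/\ (M <= p.1)%N, (p.1 < p.2)%N &
      e <= N (cut (A p.1 `\` A p.2) x)].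
    apply: contrapT => H; apply: (h M) => m n Mm mn; rewrite ltNge; apply/negP => le.
    by apply: H; exists (m, n).
  have [g gP] := choice h.
  (* [g (M k)] is a pair of indices beyond [M k] with a large difference; starting the next search
     at its second entry makes the chosen differences disjoint. *)
  pose M := fix M k := if k is k'.+1 then (g (M k')).2 else 0%N.
  have Mle j k : (j <= k)%N -> (M j <= M k)%N.
    move=> /subnK <-; elim: (k - j)%N => [//|i IH]; rewrite addSn /=.
    have [h1 h2 _] := gP (M (i + j)%N); exact: leq_trans IH (leq_trans h1 (ltnW h2)).
  have lt j k t : (j < k)%N -> (A (g (M j)).1 `\` A (g (M j)).2) t ->
      ~ (A (g (M k)).1 `\` A (g (M k)).2) t.
    move=> jk [_ h1] [h2 _]; apply: h1; apply: dec h2.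
    by have [h3 _ _] := gP (M k); apply: leq_trans h3; exact: (Mle j.+1 k jk).
  have dB j k t : (A (g (M j)).1 `\` A (g (M j)).2) t ->
      (A (g (M k)).1 `\` A (g (M k)).2) t -> j = k.
    move=> hj hk; have [jk|kj|//] := ltngtP j k.
      by case: (lt j k t jk hj hk).
    by case: (lt k j t kj hk hj).
  have [k] := disjoint_pieces_small sep mx (fun k => mD (g (M k)).1 (g (M k)).2) dB e0.
  by have [_ _] := gP (M k); rewrite leNgt => /negP.
pose s n := cut (~` A n) x.
have ms n : mem (s n) by exact: mem_cut.
have sD m n : (m <= n)%N -> s n \- s m = cut (A m `\` A n) x.
  move=> mn; apply/funext => t; rewrite /s /=.
  have [An|An] := pselect (A n t).
    have Am := dec _ _ mn _ An.
    rewrite (cut_notin x (A := ~` A n)); last by move=> h; exact: h An.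
    rewrite (cut_notin x (A := ~` A m)); last by move=> h; exact: h Am.
    by rewrite subrr cut_notin // => -[].
  rewrite (cut_in x (A := ~` A n)) //; have [Am|Am] := pselect (A m t).
    by rewrite (cut_notin x (A := ~` A m)) // subr0 cut_in.
  by rewrite (cut_in x (A := ~` A m)) // subrr cut_notin // => -[].
have smallD m n e : (m <= n)%N -> 0 < e -> N (cut (A m `\` A n) x) < e \/ (m < n)%N.
  rewrite leq_eqVlt => /orP[/eqP ->|]; last by right.
  move=> e0; left; rewrite setDv (_ : cut _ _ = fun=> 0) ?norm0 //.
  by apply/funext => t; rewrite cut_notin.
have [y [my ycv]] : exists y, mem y /\ (fun n => N (y \- s n)) @ \oo --> (0 : R).
  apply: ss_complete => // e e0; have [M hM] := small e e0; exists M.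
  have H m n : (M <= m)%N -> (m <= n)%N -> N (s n \- s m) < e.
    move=> Mm mn; rewrite sD //; have [//|lt] := smallD m n e mn e0; exact: hM.
  move=> m n Mm Mn; have [mn|/ltnW nm] := leqP m n; last exact: H.
  by rewrite norm_subC //; exact: H.
have yx : aeq y x.
  have h m : {ae mu, forall t, I01 t -> cut (~` A m) (y \- x) t = 0}.
    have mm : mem (cut (~` A m) (y \- x)) by apply: mem_cut => //; exact: memB.
    apply/(ss_norm_eq0 mm).1/eqP; rewrite eq_le ss_norm_ge0 // andbT.
    apply/ler_addgt0Pr => e e0; rewrite add0r; have [n hn] := cvg_norm_eps ycv e0.
    have -> : cut (~` A m) (y \- x) = cut (~` A m) (y \- s (maxn n m)).
      apply/funext => t; have [Am|Am] := pselect (A m t); first by rewrite !cut_notin //=; apply.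
      rewrite !cut_in //= /s cut_in // => At; apply: Am; apply: dec At; exact: leq_maxr.
    apply: le_trans (norm_cut (mC m) (memB my (ms _))) _.
    by apply: ltW; apply: hn; exact: leq_maxl.
  have h' : {ae mu, forall t, forall m, I01 t -> cut (~` A m) (y \- x) t = 0}.
    exact: (@ae_foralln _ _ _ mu (fun m t => I01 t -> cut (~` A m) (y \- x) t = 0) h).
  apply: ae_imp2 _ h' A0 => t ht hn It; have [n An] := hn It.
  have := ht n It; rewrite cut_in //= => /eqP; rewrite subr_eq0 => /eqP //.
move=> e e0; have [n hn] := cvg_norm_eps ycv e0; exists n => m nm.
have E : N (cut (A m) x) = N (y \- s m).
  apply: norm_aeq; [exact: mem_cut|exact: memB|].
  apply: ae_imp _ yx => t yx It /=; rewrite yx // /s.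
  have [Am|Am] := pselect (A m t); first by rewrite cut_in // cut_notin ?subr0 //; apply.
  by rewrite cut_notin // cut_in // subrr.
by rewrite E; exact: hn.
Qed.

End AbsoluteContinuity.

(** * Approximation in measure by dyadic step functions *)

Section DyadicApproximation.
Variable R : realType.
Local Notation mu := (@lebesgue_measure R).
Implicit Types (x y f g : R -> R) (A B K : set R) (c d e r s t M : R) (k m n : nat).
Implicit Types (xi : seq bool -> R).

Lemma half_pow_small e : 0 < e -> exists n, forall m, (n <= m)%N -> 2 ^- m < e.
Proof.
move=> e0; have [n _ hn] := near_infty_natSinv_lt (PosNum e0).
exists n => m nm; apply: le_lt_trans (hn m nm); rewrite lef_pV2 ?posrE ?exprn_gt0 //.
by rewrite -natrX ler_nat ltn_expl.
Qed.

Lemma compact_unif_cont K g d : compact K -> {within K, continuous g} -> 0 < d ->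
  exists n, forall s t, K s -> K t -> `|s - t| <= 2 ^- n -> `|g s - g t| < d.
Proof.
move=> cK /subspace_continuousP cg d0.
pose P n s := forall t, K t -> `|s - t| <= 2 ^- n -> `|g s - g t| < d.
have [n _ /(_ n (leqnn n)) hn] : \forall n \near \oo, K `<=` P n.
  have /compact_near_coveringP/near_covering_withinP h := cK.
  suff loc (x : R) : K x -> \forall x' \near x & i \near \oo, K x' -> P i x'.
    by apply: (h nat \oo P) => x; exact: loc.
  move=> Kx.
  have d2 : 0 < d / 2 by rewrite divr_gt0.
  have /cvgrPdist_lt /(_ _ d2) := cg x Kx.
  move=> /nbhs_ballP [r /= r0' hr]; have r0 : 0 < r := r0'.
  have [n hn] := half_pow_small (divr_gt0 r0 (ltr0Sn R 1)).
  exists (ball x (r / 2), [set m | (n <= m)%N]) => /=.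
    split; last by exists n.
    by apply: nbhsx_ballx; rewrite divr_gt0.
  move=> [s m] /= [xs nm] Ks t Kt st.
  have h2 : 2 ^- m < r / 2 := hn m nm.
  have xs' : `|x - s| < r / 2 by [].
  have gs : `|g x - g s| < d / 2.
    have xr : `|x - s| < r.
      by apply: lt_trans xs' _; rewrite ltr_pdivrMr // ltr_pMr // ltr1n.
    exact: hr xr Ks.
  have gt : `|g x - g t| < d / 2.
    have st' : `|s - t| < r / 2 := le_lt_trans st h2.
    have xr : `|x - t| < r.
      by apply: le_lt_trans (ler_distD s _ _) _; rewrite [r]splitr; exact: ltrD.
    exact: hr xr Kt.
  apply: le_lt_trans (ler_distD (g x) _ _) _; rewrite [d]splitr distrC; exact: ltrD.
by exists n => s t Ks Kt; exact: hn.
Qed.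

(* On the dyadic intervals of length [2^-k] that meet [K], the step function
   takes a value of [g] on [K]. *)
Lemma dyadic_step_approx k K g d M : 0 <= M -> (forall t, I01 t -> `|g t| <= M) ->
  (forall s t, I01 s -> I01 t -> K s -> K t -> `|s - t| <= 2 ^- k -> `|g s - g t| < d) ->
  exists xi, (forall a, `|xi a| <= M) /\
    {ae mu, forall t, I01 t -> K t -> `|g t - blk chi01 xi k t| < d}.
Proof.
move=> M0; elim: k K g => [|k IH] K g gM h.
  have [[s [Ks Is]]|nK] := pselect (exists s, K s /\ I01 s).
    exists (fun=> g s); split; first by move=> _; exact: gM.
    apply: aeW => t It Kt; rewrite /blk /= /chi01.
    have It' := It; have Is' := Is; rewrite /I01 /= !in_itv /= in It' Is'.
    rewrite It' mulr1; apply: h => //; rewrite expr0 invr1.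
    by move: It' Is' => /andP[? ?] /andP[? ?]; rewrite ler_norml; apply/andP; split; lra.
  exists (fun=> 0); split; first by move=> _; rewrite normr0.
  by apply: aeW => t It Kt; case: nK; exists t.
(* The half with digit [b] is blown up to the unit interval, with [K] and [g] pulled back; distances
   double, so the modulus at scale [2^-(k+1)] becomes the one at scale [2^-k]. *)
have step (b : R) : 0 <= b <= 1 -> exists xi, (forall a, `|xi a| <= M) /\
    {ae mu, forall t, I01 t -> K ((t + b) / 2) ->
      `|g ((t + b) / 2) - blk chi01 xi k t| < d}.
  move=> /andP[b0 b1].
  have I2 t : I01 t -> I01 ((t + b) / 2).
    by rewrite /I01 /= !in_itv /= => /andP[? ?]; apply/andP; split; lra.
  apply: (IH [set t | K ((t + b) / 2)] (fun t => g ((t + b) / 2))) => [t It|s t Is It Ks Kt st].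
    by apply: gM; exact: I2.
  apply: h => //; try exact: I2.
  have -> : (s + b) / 2 - (t + b) / 2 = (s - t) / 2 by ring.
  rewrite normrM (ger0_norm (x := 2^-1)) // exprS invfM mulrC ler_pM2l //.
have [|xi0 [xi0M /(ae_affine 0) h0]] := step 0; first by rewrite lexx ler01.
have [|xi1 [xi1M /(ae_affine 1) h1]] := step 1; first by rewrite lexx ler01.
exists (fun a => if a is b :: a' then if b then xi1 a' else xi0 a' else 0); split.
  by move=> [|[] a]; rewrite ?normr0.
apply: ae_imp3 _ h0 h1 (ae_ne 2^-1) => t h0 h1 t2 It Kt.
rewrite blkS; have := It; rewrite /I01 /= in_itv /= => /andP[t0 t1].
have E0 : (2 * t - 0 + 0) / 2 = t by field.
have E1 : (2 * t - 1 + 1) / 2 = t by field.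
rewrite E0 in h0; rewrite E1 in h1.
have [lt|gt|/eqP] := ltgtP t 2^-1; last by rewrite (negPf t2).
  rewrite joinl ?t0 // -[2 * t]subr0; apply: h0 => //.
  by rewrite /I01 /= in_itv /=; apply/andP; split; lra.
rewrite joinr ?t1 ?gt //; apply: h1 => //.
by rewrite /I01 /= in_itv /=; apply/andP; split; lra.
Qed.

Lemma measurable_chi01 : measurable_fun I01 (chi01 : R -> R).
Proof.
have E : {in I01, (fun=> 1) =1 (chi01 : R -> R)}.
  by move=> t; rewrite inE /I01 /= in_itv /chi01 /= => ->.
exact: eq_measurable_fun E (measurable_cst _).
Qed.

Lemma chi01E t : I01 t -> chi01 t = 1.
Proof. by rewrite /I01 /= in_itv /= /chi01 => ->. Qed.

(** [mu (large x d) < d] expresses closeness of [x] to 0 in measure with a single parameter. *)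
Definition large x d : set R := I01 `&` [set t | d <= `|x t|].

Lemma measurable_large x d : measurable_fun I01 x -> measurable (large x d).
Proof.
move=> mx; have mB : measurable [set r : R | d <= `|r|].
  have := @normr_measurable R setT measurableT _ (measurable_itv `[d, +oo[).
  rewrite setTI; congr (measurable _); apply/seteqP.
  by split => t /=; rewrite in_itv /= andbT.
exact: (mx (@measurable_I01 R) _ mB).
Qed.

(** Lusin's theorem gives a compact [K] of nearly full measure on which [g] is continuous, hence
    uniformly continuous; the step function is close to [g] on [K]. *)
Lemma step_approx g d M : 0 <= M -> measurable_fun I01 g ->
  (forall t, I01 t -> `|g t| <= M) -> 0 < d ->
  exists k xi, (forall a, `|xi a| <= M) /\
    (mu (large (g \- blk chi01 xi k)%R d) < d%:E)%E.
Proof.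
move=> M0 mg gM d0.
have fin : (mu I01 < +oo)%E by rewrite mu_I01 ltey.
have [K [cK KI Kd cg]] := measurable_almost_continuous (@measurable_I01 R) fin d0 mg.
have [k hk] := compact_unif_cont cK cg d0.
have [||xi [xiM hxi]] := @dyadic_step_approx k K g d M M0.
- exact: gM.
- by move=> s t _ _; exact: hk.
exists k, xi; split => //; apply: le_lt_trans Kd.
have mgx : measurable_fun I01 (g \- blk chi01 xi k).
  by apply: measurable_funB => //; apply: measurable_blk; apply: measurable_chi01.
have mK : measurable K by exact: compact_measurable.
have mIK := measurableD (@measurable_I01 R) mK.
have [Z [mZ Z0 sZ]] := hxi.
rewrite -(@measureU0 _ _ _ mu _ _ mIK mZ Z0).
apply: le_measure; rewrite ?inE; [exact: (measurable_large d mgx)|exact: (measurableU _ _ mIK mZ)|].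
move=> t [It /= ht]; have [Kt|Kt] := pselect (K t); last by left.
by right; apply: sZ => /= /(_ It Kt); rewrite ltNge ht.
Qed.

End DyadicApproximation.

(** * Density of dyadic step functions in the norm *)

Section Density.
Variables (R : realType) (X : symspace R).
Local Notation mu := (@lebesgue_measure R).
Local Notation mem := (ss_mem X).
Local Notation N := (ss_norm X).
Hypothesis sepX : separable X.
Implicit Types (x y f g : R -> R) (A B K : set R) (c d e r s t M : R) (k m n : nat).
Implicit Types (xi : seq bool -> R).

Lemma mem_bounded x M : measurable_fun I01 x -> (forall t, I01 t -> `|x t| <= M) -> mem x.
Proof.
move=> mx h; apply: (mem_dom (ss_memZ M (ss_mem1 X))) => //.
by apply: aeW => t It; rewrite chi01E // mulr1 (le_trans (h t It)) // ler_norm.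
Qed.

Lemma mem_step xi k : mem (blk chi01 xi k).
Proof. apply: mem_blk; exact: ss_mem1. Qed.

Lemma distr1_cut_chi A s : distr1 (cut A chi01) s =
  if s < 0 then 1%E else if s < 1 then mu (I01 `&` A) else 0%E.
Proof.
rewrite /distr1; case: ifPn => s0; [|case: ifPn => s1].
- rewrite -(mu_I01 R); congr (mu _); apply/seteqP; split => [t []//|t It]; split => //.
  have [At|At] := pselect (A t); last by rewrite cut_notin.
  by rewrite cut_in // chi01E //; lra.
- congr (mu _); apply/seteqP; split => t [It h]; split => //; last by rewrite cut_in // chi01E.
  apply: contrapT => At; move: h; rewrite /= cut_notin //; lra.
- rewrite -(measure0 mu); congr (mu _); apply/seteqP; split => // t [It] /=.
  have [At|At] := pselect (A t); last by rewrite cut_notin //; lra.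
  by rewrite cut_in // chi01E //; lra.
Qed.

(** By symmetry the norm of a characteristic function depends only on the measure of the set, so the
    set may be moved to [[0, p]], inside one of the intervals [[0, 1/(n+1)]] shrinking to a
    point. *)
Lemma norm_chi_small e : 0 < e -> exists d, 0 < d /\ forall A, measurable A ->
  (mu (I01 `&` A) < d%:E)%E -> N (cut A chi01) < e.
Proof.
move=> e0; pose J n : set R := `[0, n.+1%:R^-1]%classic.
have mJ n : measurable (J n) by exact: measurable_itv.
have [||n /(_ n (leqnn n)) hn] := @abs_continuity R X chi01 J sepX (ss_mem1 X) mJ _ _ e e0.
- move=> n t; rewrite /J /= !in_itv /= => /andP[-> h] /=; apply: le_trans h _.
  by rewrite lef_pV2 ?posrE ?ltr0n // ler_nat.
- apply: ae_imp _ (ae_ne 0) => t t0; rewrite /I01 /= in_itv /= => /andP[t1 _].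
  have {}t0 : 0 < t by rewrite lt_def t0.
  have [n _ hn] := near_infty_natSinv_lt (PosNum t0).
  exists n; rewrite /J /= in_itv /= => /andP[_]; rewrite leNgt => /negP; apply.
  exact: (hn n (leqnn n)).
exists n.+1%:R^-1; split => [|A mA hA]; first by rewrite invr_gt0 ltr0n.
apply: le_lt_trans hn.
have mIA : measurable (I01 `&` A) by exact: measurableI.
have fA : mu (I01 `&` A) \is a fin_num.
  by rewrite ge0_fin_numE ?measure_ge0 // (lt_trans hA) // ltey.
pose p := fine (mu (I01 `&` A)).
have Ep : mu (I01 `&` A) = p%:E by rewrite fineK.
have p0 : 0 <= p by apply: fine_ge0; exact: measure_ge0.
have pn : p < n.+1%:R^-1 by rewrite -lte_fin -Ep.
have n1 : n.+1%:R^-1 <= 1 :> R by rewrite invf_le1 ?ltr0n // ler1n.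
have p1 : p < 1 := lt_le_trans pn n1.
have mP : measurable (`[0, p]%classic : set R) by exact: measurable_itv.
have E : equimeasurable (cut A chi01) (cut `[0, p] chi01).
  move=> s; rewrite !distr1_cut_chi; case: ifP => // _; case: ifP => // _.
  have -> : I01 `&` `[0, p] = `[0, p]%classic.
    apply/seteqP; split => t; first by case.
    by rewrite /I01 /= !in_itv /= => /andP[? ?]; split; apply/andP; split; lra.
  rewrite lebesgue_measure_itv /= lte_fin Ep; case: ltP => [_|]; first by rewrite sube0.
  by move=> ?; congr EFin; lra.
have mP1 := mem_cut mP (ss_mem1 X).
have [_ ->] := ss_sym mP1 (measurable_cut mA (@measurable_chi01 R)) E.
apply: norm_cut_mono => //; first exact: ss_mem1.
by move=> t; rewrite /J /= !in_itv /= => /andP[-> tp] /=; exact: le_trans tp (ltW pn).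
Qed.

(** [x] is dominated by [d'] plus [M] times the characteristic function of the set where
    [|x| >= d']. *)
Lemma norm_small_measure M e : 0 <= M -> 0 < e -> exists d, 0 < d /\
  forall x, measurable_fun I01 x -> {ae mu, forall t, I01 t -> `|x t| <= M} ->
  (mu (large x d) < d%:E)%E -> N x < e.
Proof.
move=> M0 e0.
have M1 : 0 < M + 1 by lra.
(* Dividing by [M + 1] rather than [M] allows [M = 0]. *)
have [d [d0 hd]] := norm_chi_small (divr_gt0 (divr_gt0 e0 (ltr0Sn R 1)) M1).
have [d' [d'0 d'd h2]] : exists d', [/\ 0 < d', d' <= d & d' <= e / 2].
  by exists (Num.min d (e / 2)); rewrite lt_min d0 divr_gt0 // !ge_min !lexx orbT.
exists d'; split => // x mx xM hx.
pose A := large x d'.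
have mA : measurable A by exact: measurable_large.
have hA : N (cut A chi01) < e / 2 / (M + 1).
  apply: hd => //; rewrite setIA setIid; apply: lt_le_trans hx _.
  by rewrite lee_fin.
have mC := mem_cut mA (ss_mem1 X).
have m1 := ss_memZ d' (ss_mem1 X); have m2 := ss_memZ M mC.
have : N x <= d' + M * N (cut A chi01).
  have := ss_normD m1 m2; rewrite !ss_normZ ?ss_norm1 //; last exact: ss_mem1.
  rewrite !ger0_norm ?mulr1 //; last exact: ltW.
  apply: le_trans; apply: (norm_dom (ss_memD m1 m2)) => //.
  apply: ae_imp _ xM => t xM It /=; rewrite chi01E // mulr1.
  have [At|At] := pselect (A t).
    rewrite cut_in // chi01E // mulr1 [leRHS]ger0_norm; last by lra.
    by apply: le_trans (xM It) _; lra.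
  rewrite cut_notin // mulr0 addr0 [leRHS]ger0_norm; last exact: ltW.
  by rewrite leNgt; apply/negP => h; apply: At; split => //=; exact: ltW.
have h3 : (M + 1) * N (cut A chi01) < e / 2 by rewrite mulrC -ltr_pdivlMr.
have := ss_norm_ge0 mC; lra.
Qed.

(** The estimate in measure is recorded beside the one in norm because integrals are compared
    through it, before any bound of the integral by the norm is available. *)
Lemma step_approx_bounded g M e : 0 <= M -> measurable_fun I01 g ->
  (forall t, I01 t -> `|g t| <= M) -> 0 < e ->
  exists k xi, [/\ (forall a, `|xi a| <= M), N (g \- blk chi01 xi k) < e &
    (mu (large (g \- blk chi01 xi k)%R e) < e%:E)%E].
Proof.
move=> M0 mg gM e0.
have [d [d0 hd]] := norm_small_measure (addr_ge0 M0 M0) e0.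
have de0 : 0 < Num.min d e by rewrite lt_min d0.
have [k [xi [xiM h']]] := step_approx M0 mg gM de0.
have mb := mem_step xi k.
have B0 : {ae mu, forall t, I01 t -> `|blk chi01 xi k t| <= M}.
  apply: (@tree_rel1 _ (fun p => `|p| <= M)) => a _.
  by apply: aeW => t It; rewrite chi01E // mulr1.
have mgx : measurable_fun I01 (g \- blk chi01 xi k).
  by apply: measurable_funB => //; exact: ss_meas mb.
have le_large c : Num.min d e <= c -> (mu (large (g \- blk chi01 xi k)%R c) < c%:E)%E.
  move=> hc; apply: lt_le_trans (_ : ((Num.min d e)%:E <= _)%E); last by rewrite lee_fin.
  apply: le_lt_trans h'; apply: le_measure; rewrite ?inE; try exact: (measurable_large _ mgx).
  by move=> t [It /= ht]; split => //=; exact: le_trans ht.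
have h : (mu (large (g \- blk chi01 xi k)%R d) < d%:E)%E by apply: le_large; rewrite ge_min lexx.
exists k, xi; split => //; last by apply: le_large; rewrite ge_min lexx orbT.
apply: hd => //; apply: ae_imp _ B0 => t Bt It /=; apply: le_trans (ler_normB _ _) _.
by apply: lerD; [exact: gM|exact: Bt].
Qed.

(** The sets where [|x| >= n] decrease to the empty set, so absolute continuity makes the cut of [x]
    to them small. *)
Lemma trunc_approx x e : mem x -> 0 < e -> exists M g, [/\ 0 <= M, measurable_fun I01 g,
  (forall t, I01 t -> `|g t| <= M) & N (x \- g) < e].
Proof.
move=> mx e0; pose A n := large x n%:R.
have mA n : measurable (A n) by apply: measurable_large; exact: ss_meas mx.
have [||n /(_ n (leqnn n)) hn] := @abs_continuity R X x A sepX mx mA _ _ e e0.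
- move=> n t [It /= h]; split => //=; apply: le_trans h; by rewrite ler_nat.
- apply: aeW => t It; have [n _ hn] := nbhs_infty_gtr (`|x t|).
  by exists n => -[_ /=]; rewrite leNgt (hn n (leqnn n)).
exists n%:R, (cut (~` A n) x); split => //.
- by apply: measurable_cut; [exact: measurableC|exact: ss_meas mx].
- move=> t It; have [At|At] := pselect (A n t).
    by rewrite cut_notin ?normr0 //; apply.
  rewrite cut_in // leNgt; apply/negP => h; apply: At; split => //; exact: ltW.
- rewrite (_ : _ \- _ = cut (A n) x) //; apply/funext => t /=.
  have [At|At] := pselect (A n t); first by rewrite cut_notin ?cut_in ?subr0 //; apply.
  by rewrite cut_in // cut_notin // subrr.
Qed.

Lemma step_dense x e : mem x -> 0 < e -> exists k xi M,
  [/\ 0 <= M, forall a, `|xi a| <= M & N (x \- blk chi01 xi k) < e].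
Proof.
move=> mx e0; have e2 : 0 < e / 2 by rewrite divr_gt0.
have [M [g [M0 mg gM h]]] := trunc_approx mx e2.
have [k [xi [xiM h' _]]] := step_approx_bounded M0 mg gM e2.
exists k, xi, M; split => //.
have := norm_tri mx (mem_step xi k) (mem_bounded mg gM); lra.
Qed.

End Density.

(** * The integral on dyadic blocks and the embedding into [L_1] *)

Section Integral.
Variables (R : realType) (X : symspace R).
Local Notation mu := (@lebesgue_measure R).
Local Notation mem := (ss_mem X).
Local Notation N := (ss_norm X).
Implicit Types (x y f g u v : R -> R) (c d e r s t M : R) (k m n : nat).
Implicit Types (xi : seq bool -> R).

(* [lebesgue_measure] carries the display of the generated sigma-algebra. *)
Let mI : (R.-ocitv.-measurable).-sigma.-measurable (I01 : set R).
Proof. exact: measurable_I01. Qed.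

Definition intbl x := mu.-integrable I01 (EFin \o x).
Definition J x := \int[mu]_(t in I01) x t.

Lemma measurable_EFin x : measurable_fun I01 x -> measurable_fun I01 (EFin \o x).
Proof. by move=> /measurable_EFinP. Qed.

Lemma intbl_measurable x : intbl x -> measurable_fun I01 x.
Proof. by move=> /integrableP[/measurable_EFinP]. Qed.

Lemma intbl_lin c x y : intbl x -> intbl y -> intbl (fun t => c * x t + y t).
Proof.
move=> ix iy; have := integrableD mI (integrableZl mI c ix) iy.
by congr (integrable _ _ _).
Qed.

Lemma J_lin c x y : intbl x -> intbl y -> J (fun t => c * x t + y t) = c * J x + J y.
Proof.
move=> ix iy; have icx := integrableZl mI c ix.
by rewrite /J (RintegralD mI icx iy) (RintegralZl _ mI ix).
Qed.

Lemma abs_J x : intbl x -> `|J x| <= J (fun t => `|x t|).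
Proof. by move=> ix; exact: (le_normr_Rintegral mI ix). Qed.

(** Common form of [V0] ([b = 0]) and [V1] ([b = 1]), so that the change of variables is made
    once. *)
Definition Vpiece (b : R) u : R -> R :=
  fun t => if b / 2 <= t <= (b + 1) / 2 then u (2 * t - b) else 0.

Lemma V0E u : V0 u = Vpiece 0 u.
Proof. by apply/funext => t; rewrite /V0 /Vpiece mul0r add0r div1r subr0. Qed.

Lemma V1E u : V1 u = Vpiece 1 u.
Proof.
apply/funext => t; rewrite /V1 /Vpiece div1r (_ : (1 + 1) / 2 = 1 :> R) //.
by rewrite divff // pnatr_eq0.
Qed.

Lemma measurable_Vpiece b u : measurable_fun I01 u -> measurable_fun I01 (Vpiece b u).
Proof.
move=> mu_; apply: measurable_funTS; apply: measurable_piece => // t /andP[? ?].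
by apply/andP; split; lra.
Qed.

Lemma ge0_integral_Vpiece b u : 0 <= b <= 1 -> measurable_fun I01 u ->
  (forall t, I01 t -> 0 <= u t) ->
  (\int[mu]_(t in I01) (Vpiece b u t)%:E = (2^-1)%:E * \int[mu]_(t in I01) (u t)%:E)%E.
Proof.
move=> /andP[b0 b1] mu_ u0.
pose phi := (fun t : measurableTypeR R => (2 * t - b : measurableTypeR R)).
have mphi : measurable_fun setT phi := measurable_affine b.
have mE := measurable_EFin mu_.
have u0' : {in (I01 : set R), forall t, (0 <= (EFin \o u) t)%E}.
  by move=> t; rewrite inE => It; rewrite lee_fin u0.
have preE : phi @^-1` I01 = `[b / 2, (b + 1) / 2]%classic.
  by apply/seteqP; split => t; rewrite /phi /I01 /= !in_itv /= => /andP[? ?]; apply/andP; split; lra.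
transitivity (\int[mu]_(t in phi @^-1` I01) ((EFin \o u) \o phi) t)%E.
  rewrite preE integral_mkcond [RHS]integral_mkcond; apply: eq_integral => t _.
  rewrite !patchE /Vpiece; have [h|h] := boolP (b / 2 <= t <= (b + 1) / 2).
    have It : I01 t by move: h; rewrite /I01 /= in_itv /= => /andP[? ?]; apply/andP; split; lra.
    have Vt : `[b / 2, (b + 1) / 2]%classic t by rewrite /= in_itv.
    by rewrite (mem_set It) (mem_set Vt).
  have Vt : ~ `[b / 2, (b + 1) / 2]%classic t by rewrite /= in_itv /=; exact/negP.
  by rewrite (memNset Vt) if_same.
rewrite -(ge0_integral_pushforward mphi mu mI mE u0').
have h0 : 0 <= 2^-1 :> R by rewrite invr_ge0.
rewrite -(ge0_integral_mscale mu mI (NngNum h0) mE); last first.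
  by move=> t It; rewrite lee_fin u0.
by apply: eq_measure_integral => A mA _; exact: mu_affine.
Qed.

Lemma integral_Vpiece b u : 0 <= b <= 1 -> intbl u ->
  intbl (Vpiece b u) /\ J (Vpiece b u) = J u / 2.
Proof.
move=> b01 iu; have mu_ := intbl_measurable iu; have mV := measurable_Vpiece b mu_.
split.
  apply/integrableP; split; first exact: measurable_EFin.
  have E : (\int[mu]_(t in I01) `|(EFin \o Vpiece b u) t| =
      (2^-1)%:E * \int[mu]_(t in I01) `|(EFin \o u) t|)%E.
    rewrite -(@ge0_integral_Vpiece b (fun t => `|u t|)) //; last first.
      exact: measurableT_comp.
    by apply: eq_integral => t _ /=; rewrite /Vpiece; case: ifP => //; rewrite normr0.
  rewrite E; move/integrableP: iu => [_ fin].
  by apply: lte_mul_pinfty => //; rewrite lee_fin invr_ge0.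
(* The change of variables is known for nonnegative functions; [Vpiece] commutes with positive and
   negative parts. *)
rewrite /J /Rintegral integralE [X in _ = fine X / 2]integralE.
have pE (w : R -> R) : (EFin \o w)^\+%E = EFin \o (fun t => Num.max (w t) 0).
  by apply/funext => t /=; rewrite funeposE /= EFin_max.
have nE (w : R -> R) : (EFin \o w)^\-%E = EFin \o (fun t => Num.max (- w t) 0).
  by apply/funext => t /=; rewrite funenegE /= EFin_max.
have mp : measurable_fun I01 (fun t => Num.max (u t) 0).
  by apply: measurable_maxr => //; exact: measurable_cst.
have mn : measurable_fun I01 (fun t => Num.max (- u t) 0).
  by apply: measurable_maxr; [exact: measurable_funN|exact: measurable_cst].
have Vp : (fun t => Num.max (Vpiece b u t) 0) = Vpiece b (fun t => Num.max (u t) 0).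
  by apply/funext => t; rewrite /Vpiece; case: ifP => // _; rewrite maxxx.
have Vn : (fun t => Num.max (- Vpiece b u t) 0) = Vpiece b (fun t => Num.max (- u t) 0).
  by apply/funext => t; rewrite /Vpiece; case: ifP => // _; rewrite oppr0 maxxx.
have fp := integrable_pos_fin_num mI iu.
have fn := integrable_neg_fin_num mI iu.
rewrite !pE !nE Vp Vn in fp fn *.
rewrite !ge0_integral_Vpiece //; try by move=> t _; rewrite le_max lexx orbT.
move: fp fn; case: (\int[mu]_(x in I01) _)%E => [p| |] // _.
case: (\int[mu]_(x in I01) _)%E => [q| |] // _.
by rewrite -!EFinM -!EFinB /=; field.
Qed.

Lemma intbl_join u v : intbl u -> intbl v -> intbl (join u v).
Proof.
move=> iu iv; have [|i0 _] := @integral_Vpiece 0 u _ iu; first by rewrite lexx ler01.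
have [|i1 _] := @integral_Vpiece 1 v _ iv; first by rewrite lexx ler01.
rewrite /join V0E V1E; have := intbl_lin 1 i0 i1; congr intbl.
by apply/funext => t; rewrite mul1r.
Qed.

Lemma J_join u v : intbl u -> intbl v -> J (join u v) = (J u + J v) / 2.
Proof.
move=> iu iv; have [|i0 e0] := @integral_Vpiece 0 u _ iu; first by rewrite lexx ler01.
have [|i1 e1] := @integral_Vpiece 1 v _ iv; first by rewrite lexx ler01.
have := J_lin 1 i0 i1; rewrite e0 e1 /join V0E V1E mul1r -mulrDl => <-.
by congr J; apply/funext => t; rewrite mul1r.
Qed.

Lemma intbl_tree (u : seq bool -> R -> R) k : (forall a, intbl (u a)) -> intbl (tree u k).
Proof. by elim: k u => [|k IH] u h /=; [exact: h|apply: intbl_join; exact: IH]. Qed.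

Lemma intblZ c x : intbl x -> intbl (fun t => c * x t).
Proof. by move=> ix; have := integrableZl mI c ix. Qed.

Lemma JZ c x : intbl x -> J (fun t => c * x t) = c * J x.
Proof. by move=> ix; rewrite /J RintegralZl. Qed.

Lemma intbl_blk f xi k : intbl f -> intbl (blk f xi k).
Proof. by move=> i; apply: intbl_tree => a; exact: intblZ. Qed.

Lemma J_blk f xi k : intbl f -> J (blk f xi k) = avg xi k * J f.
Proof.
move=> i; elim: k xi => [|k IH] xi; first by rewrite /blk /= JZ.
by rewrite blkS J_join ?IH /=; [field|exact: intbl_blk|exact: intbl_blk].
Qed.

Lemma intbl_bounded x M : measurable_fun I01 x -> (forall t, I01 t -> `|x t| <= M) -> intbl x.
Proof.
move=> mx h; have fin : (mu I01 < +oo)%E by rewrite mu_I01 ltey.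
apply: (measurable_bounded_integrable mI fin mx).
by exists M; split; [exact: num_real|move=> y My t /= It; apply: le_trans (h t It) (ltW My)].
Qed.

Lemma intbl_chi : intbl chi01.
Proof.
apply: (@intbl_bounded _ 1); first exact: measurable_chi01.
by move=> t It; rewrite chi01E // normr1.
Qed.

Lemma J_chi : J chi01 = 1.
Proof.
rewrite /J (@eq_Rintegral _ _ _ mu I01 (fun=> 1)); last by move=> t; rewrite inE => It; rewrite chi01E.
have := Rintegral_cst mu mI 1; rewrite -[X in fine X]/(mu I01) mu_I01 mul1r; exact.
Qed.

Lemma J_step xi k : J (blk chi01 xi k) = avg xi k.
Proof. by rewrite J_blk ?J_chi ?mulr1 //; exact: intbl_chi. Qed.

(** [|x|] is at most [M] on [large x e] and at most [e] off it. *)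
Lemma abs_J_small x e M : 0 <= e -> 0 <= M -> intbl x ->
  {ae mu, forall t, I01 t -> `|x t| <= M} -> (mu (large x e) < e%:E)%E ->
  `|J x| <= e + M * e.
Proof.
move=> e0 M0 ix h hl; apply: le_trans (abs_J ix) _.
have mx := intbl_measurable ix; have mL := measurable_large e mx.
have mMe : measurable_fun I01 (fun t => M * (\1_(large x e) t : R) + e).
  apply: measurable_funD; last exact: measurable_cst.
  by apply: measurable_scale; exact: measurable_indic.
have fin : mu (large x e) \is a fin_num.
  by rewrite ge0_fin_numE ?measure_ge0 // (lt_trans hl) // ltey.
have fe : fine (mu (large x e)) < e by rewrite -lte_fin fineK.
have E : (\int[mu]_(t in I01) (M * (\1_(large x e) t : R) + e)%:E =
    (M * fine (mu (large x e)) + e)%:E)%E.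
  under eq_integral do rewrite EFinD EFinM.
  have m1 : measurable_fun I01 (fun t => (\1_(large x e) t : R)%:E).
    by apply: measurable_EFin; exact: measurable_indic.
  have m2 : measurable_fun I01 (fun t => (M%:E * (\1_(large x e) t : R)%:E)%E).
    exact: (measurable_EFin (measurable_scale M (measurable_indic mL))).
  rewrite (ge0_integralD mu mI _ m2 _ (measurable_cst _)); last 2 first.
  - by move=> t _; rewrite mule_ge0 ?lee_fin.
  - by move=> t _; rewrite lee_fin.
  rewrite (ge0_integralZl mu mI m1) ?lee_fin //.
  rewrite (integral_indic mu mI mL) (integral_cst mu mI) -[X in (_ + _ * X)%E]/(mu I01) mu_I01.
  rewrite -[X in (_ * X + _)%E]/(mu (large x e `&` I01)).
  by rewrite setIidl; [rewrite mule1 EFinD EFinM fineK|move=> t []].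
have le : (\int[mu]_(t in I01) `|x t|%:E <= (M * fine (mu (large x e)) + e)%:E)%E.
  rewrite -E; apply: ae_ge0_le_integral => //.
  - by apply: measurable_EFin; exact: measurableT_comp.
  - by move=> t _; rewrite lee_fin addr_ge0 // mulr_ge0.
  - exact: measurable_EFin.
  apply: ae_imp _ h => t h It; rewrite lee_fin indicE.
  have [Lt|Lt] := pselect (large x e t).
    by rewrite mem_set // mulr1; have := h It; lra.
  rewrite memNset // mulr0 add0r leNgt; apply/negP => hlt; apply: Lt; split => //=; exact: ltW.
have : J (fun t => `|x t|) <= M * fine (mu (large x e)) + e.
  rewrite /J /Rintegral -lee_fin fineK //.
  have i2 : intbl (fun t => `|x t|).
    by move: ix => /(integrable_abse (mu:=mu)); congr (integrable _ _ _).
  exact: integrable_fin_num.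
have : M * fine (mu (large x e)) <= M * e by rewrite ler_wpM2l // ltW.
lra.
Qed.

Hypothesis sepX : separable X.

(** For a step function this is [abs_avg_le]. Passing to [g] costs [e + 2 * M * e] for the integral
    and [e] for the norm, which sum to [d] by the choice of [e]. *)
Lemma abs_J_bounded g M : 0 <= M -> measurable_fun I01 g ->
  (forall t, I01 t -> `|g t| <= M) -> `|J g| <= N g.
Proof.
move=> M0 mg gM; apply/ler_addgt0Pr => d d0.
pose e := d / (M + M + 2); have D0 : 0 < M + M + 2 by lra.
have e0 : 0 < e by rewrite divr_gt0.
have [k [xi [xiM hN hm]]] := step_approx_bounded sepX M0 mg gM e0.
have ig := intbl_bounded mg gM; have is' := intbl_blk xi k intbl_chi.
have E : g \- blk chi01 xi k = (fun t => -1 * blk chi01 xi k t + g t).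
  by apply/funext => t /=; rewrite mulN1r addrC.
have id : intbl (g \- blk chi01 xi k) by rewrite E; exact: intbl_lin.
have JE : J (g \- blk chi01 xi k) = J g - avg xi k.
  by rewrite E J_lin // J_step mulN1r addrC.
have B0 : {ae mu, forall t, I01 t -> `|blk chi01 xi k t| <= M}.
  apply: (@tree_rel1 _ (fun p => `|p| <= M)) => a _.
  by apply: aeW => t It; rewrite chi01E // mulr1.
have h1 : `|J g - avg xi k| <= e + (M + M) * e.
  rewrite -JE; apply: abs_J_small => //; [exact: ltW|exact: addr_ge0|].
  apply: ae_imp _ B0 => t Bt It /=; apply: le_trans (ler_normB _ _) _.
  by apply: lerD; [exact: gM|exact: Bt].
have h2 := abs_avg_le X xi k.
have mG := mem_bounded X mg gM; have mS := mem_step X xi k.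
have h3 := norm_triD mS mG; rewrite norm_subC // in h3.
have h4 : `|J g| <= `|J g - avg xi k| + `|avg xi k|.
  by rewrite -{1}(subrK (avg xi k) (J g)); exact: ler_normD.
have h5 : (M + M + 2) * e = d by rewrite /e mulrC divfK // gt_eqF.
lra.
Qed.

(** Monotone convergence along the truncations of [|x|] at height [n]. The integral is
    extended-valued because the integrability of [x] is what is being derived. *)
Lemma integral_abs_le x : mem x -> (\int[mu]_(t in I01) `|x t|%:E <= (N x)%:E)%E.
Proof.
move=> mx; have mmx := ss_meas mx.
pose g n t : R := Num.min `|x t| n%:R.
have mg n : measurable_fun I01 (g n).
  by apply: measurable_minr; [exact: measurableT_comp|exact: measurable_cst].
have g0 n t : 0 <= g n t by rewrite /g le_min normr_ge0 ler0n.
have gM n t : I01 t -> `|g n t| <= n%:R.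
  by move=> _; rewrite ger0_norm // /g ge_min lexx orbT.
have nn n t : I01 t -> (0 <= (g n t)%:E)%E by move=> _; rewrite lee_fin.
have nd t : I01 t -> {homo (fun n => (g n t)%:E) : m n / (m <= n)%N >-> (m <= n)%E}.
  by move=> _ m n mn; rewrite lee_fin /g le_min !ge_min lexx /= ler_nat mn orbT.
have cv := @cvg_monotone_convergence _ _ _ mu _ mI _ (fun n => measurable_EFin (mg n)) nn nd.
have E : (fun t => limn (fun n => (g n t)%:E)) = (fun t => `|x t|%:E).
  apply/funext => t; apply: lim_near_cst => //.
  have [n _ hn] := nbhs_infty_gtr (`|x t|); exists n => // m nm.
  by rewrite /g min_l // ltW // hn.
rewrite E in cv.
rewrite -(cvg_lim _ cv) //; apply: lime_le; first by apply/cvg_ex; eexists; exact: cv.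
apply: nearW => n.
have ig := intbl_bounded (mg n) (@gM n).
rewrite -[leLHS]fineK; last exact: (integrable_fin_num mI ig).
rewrite lee_fin; apply: le_trans (ler_norm _) _; apply: le_trans (abs_J_bounded _ (mg n) (@gM n)) _ => //.
apply: (norm_dom mx) => //; apply: aeW => t It.
by rewrite ger0_norm // /g ge_min lexx.
Qed.

Lemma intbl_mem x : mem x -> intbl x.
Proof.
move=> mx; apply/integrableP; split; first by apply: measurable_EFin; exact: ss_meas mx.
by apply: le_lt_trans (integral_abs_le mx) _; rewrite ltey.
Qed.

Lemma abs_J_le x : mem x -> `|J x| <= N x.
Proof.
move=> mx; apply: le_trans (abs_J (intbl_mem mx)) _.
rewrite -lee_fin fineK; first exact: integral_abs_le.
rewrite ge0_fin_numE; last by apply: integral_ge0 => t _; rewrite lee_fin.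
by apply: le_lt_trans (integral_abs_le mx) _; rewrite ltey.
Qed.

End Integral.

(** * Distribution of tensor products on the square *)

Section ProductDistribution.
Variable R : realType.
Local Notation mu := (@lebesgue_measure R).
Implicit Types (y z f g u v : R -> R) (c d e r s t x M : R) (k m n : nat).
Implicit Types (xi : seq bool -> R).

Definition above s : set R := [set r | s < `|r|].

Lemma measurable_above s : measurable (above s).
Proof. exact: measurable_abs_gt. Qed.

Definition tset f y s : set (R * R) := [set p | I2 p /\ s < `|tensor f y p|].

Lemma measurable_I2 : measurable (I2 : set (R * R)).
Proof.
have -> : I2 = I01 `*` I01 :> set (R * R) by [].
by apply: measurableX; exact: measurable_I01.
Qed.

Lemma measurable_tensor f y : measurable_fun I01 f -> measurable_fun I01 y ->
  measurable_fun I2 (tensor f y).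
Proof.
move=> mf my; rewrite /tensor.
have s1 : (@fst R R) @` I2 `<=` (I01 : set R) by move=> _ [p [? ?] <-].
have s2 : (@snd R R) @` I2 `<=` (I01 : set R) by move=> _ [p [? ?] <-].
have m1 : measurable_fun I2 (@fst R R) by apply: measurable_funTS; exact: measurable_fst.
have m2 : measurable_fun I2 (@snd R R) by apply: measurable_funTS; exact: measurable_snd.
have h1 := measurable_comp (@measurable_I01 R) s1 mf m1.
have h2 := measurable_comp (@measurable_I01 R) s2 my m2.
exact: (@measurable_funM _ _ R _ _ _ h1 h2).
Qed.

Lemma measurable_tset f y s : measurable_fun I01 f -> measurable_fun I01 y ->
  measurable (tset f y s).
Proof.
move=> mf my; have := measurable_tensor mf my measurable_I2 (measurable_above s); exact.
Qed.

Definition slice f y s : R -> \bar R := mu \o xsection (tset f y s).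

Lemma distr2E f y s : distr2 (tensor f y) s = (\int[mu]_x slice f y s x)%E.
Proof. by []. Qed.

Lemma measurable_slice f y s : measurable_fun I01 f -> measurable_fun I01 y ->
  measurable_fun setT (slice f y s).
Proof. by move=> mf my; exact: (measurable_fun_xsection mu (measurable_tset s mf my)). Qed.

Lemma slice_ge0 f y s x : (0 <= slice f y s x)%E.
Proof. exact: measure_ge0. Qed.

Lemma slice_out f y s x : ~ I01 x -> slice f y s x = 0%E.
Proof.
move=> nx; rewrite /slice /= -(measure0 mu); congr (mu _); apply/seteqP; split => // t.
by rewrite /xsection /= inE => -[[/= Ix]].
Qed.

Lemma slice_in f y s x : I01 x -> slice f y s x = law (fun t => f x * y t) (above s).
Proof.
move=> Ix; rewrite /slice /law /=; congr (mu _); apply/seteqP; split => t.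
  by rewrite /xsection /= inE => -[[/= _ It] h].
by move=> [It h]; rewrite /xsection /= inE; split.
Qed.

(** The product measure integrates the measures of the vertical sections, and on each section [f x]
    is a constant factor, so [law_join] applies under the integral. *)
Lemma distr2_join f u v s : measurable_fun I01 f -> measurable_fun I01 u -> measurable_fun I01 v ->
  distr2 (tensor f (join u v)) s =
  ((2^-1)%:E * (distr2 (tensor f u) s + distr2 (tensor f v) s))%E.
Proof.
move=> mf mu_ mv; rewrite !distr2E.
have m1 := measurable_slice s mf mu_; have m2 := measurable_slice s mf mv.
have mT : (R.-ocitv.-measurable).-sigma.-measurable (setT : set R) by exact: measurableT.
have p1 x : setT x -> (0 <= slice f u s x)%E by move=> _; exact: slice_ge0.
have p2 x : setT x -> (0 <= slice f v s x)%E by move=> _; exact: slice_ge0.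
rewrite -(ge0_integralD mu mT p1 m1 p2 m2).
have m3 : measurable_fun setT (fun x => (slice f u s x + slice f v s x)%E).
  exact: (emeasurable_funD m1 m2).
rewrite -(ge0_integralZl mu mT m3); last 2 first.
- by move=> x _; exact: adde_ge0 (p1 x I) (p2 x I).
- by rewrite lee_fin invr_ge0.
apply: eq_integral => x _; have [Ix|Ix] := pselect (I01 x); last first.
  by rewrite !slice_out // adde0 mule0.
have mu_x := measurable_scale (f x) mu_; have mv_x := measurable_scale (f x) mv.
rewrite !slice_in // -(law_join mu_x mv_x (measurable_above s)).
rewrite (_ : (fun t => f x * join u v t) = join (fun t => f x * u t) (fun t => f x * v t)) //.
apply/funext => t; rewrite /join /V0 /V1 /=.
by case: ifP => _; case: ifP => _; ring.
Qed.

Lemma distr2_chi f c s : measurable_fun I01 f ->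
  distr2 (tensor f (fun t => c * chi01 t)) s = law (fun t => c * f t) (above s).
Proof.
move=> mf; have mcf := measurable_scale c mf.
have mA := mcf (@measurable_I01 R) _ (measurable_above s).
transitivity ((mu \x mu)%E ((I01 `&` (fun t => (c * f t)%R) @^-1` above s) `*` (I01 : set R))).
  congr ((_ \x _)%E _); apply/seteqP; split => -[p q] /=.
    by move=> [[/= Ip Iq]]; rewrite /tensor /= chi01E // mulr1 mulrC.
  by move=> [[/= Ip h] Iq]; split => //; rewrite /tensor /= chi01E // mulr1 mulrC.
have := @product_measure1E _ _ _ _ _ mu mu _ _ mA (@measurable_I01 R).
by rewrite -[X in (_ * X)%E]/(mu I01) mu_I01 mule1.
Qed.

(** Both sides satisfy the same recursion over [join]; at level 0 the set is a rectangle. This is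
    the equimeasurability of a block with the tensor product of [f] and the step function. *)
Lemma distr2_step f xi k s : measurable_fun I01 f ->
  distr2 (tensor f (blk chi01 xi k)) s = law (blk f xi k) (above s).
Proof.
move=> mf; elim: k xi => [|k IH] xi; first exact: distr2_chi.
have mS xi' := measurable_blk xi' k (@measurable_chi01 R).
have mB xi' := measurable_blk xi' k mf.
by rewrite !blkS distr2_join // law_join ?IH //; exact: measurable_above.
Qed.

(** The section at [x] compares [y] and [z] at the level [s / |f x|], and it is empty if [f x = 0]
    because [s >= 0]. Integrating the uniform error [e] over the unit interval gives [e] again. *)
Lemma distr2_le f y z e : 0 <= e -> measurable_fun I01 f -> measurable_fun I01 y ->
  measurable_fun I01 z ->
  (forall s, 0 <= s -> (law y (above s) <= law z (above s) + e%:E)%E) ->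
  forall s, 0 <= s -> (distr2 (tensor f y) s <= distr2 (tensor f z) s + e%:E)%E.
Proof.
move=> e0 mf my mz h s s0; rewrite !distr2E.
have mT : (R.-ocitv.-measurable).-sigma.-measurable (setT : set R) by exact: measurableT.
have mI : (R.-ocitv.-measurable).-sigma.-measurable (I01 : set R) by exact: measurable_I01.
have m1 := measurable_slice s mf my; have m2 := measurable_slice s mf mz.
have p2 x : setT x -> (0 <= slice f z s x)%E by move=> _; exact: slice_ge0.
have m3 : measurable_fun setT (fun x => (e%:E * (\1_(I01 : set R) x : R)%:E)%E).
  have mi : measurable_fun setT (\1_(I01 : set R) : R -> R) by exact: measurable_indic.
  have mc : measurable_fun setT (fun t => e * (\1_(I01 : set R) t : R)).
    by apply: (@measurable_funM _ _ R _ (cst e)) => //; exact: measurable_cst.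
  by have /measurable_EFinP := mc.
have p3 x : setT x -> (0 <= e%:E * (\1_(I01 : set R) x : R)%:E)%E.
  by move=> _; rewrite mule_ge0 ?lee_fin.
have -> : e%:E = (\int[mu]_x (e%:E * (\1_(I01 : set R) x : R)%:E))%E.
  have m4 : measurable_fun setT (fun x => (\1_(I01 : set R) x : R)%:E).
    by apply/measurable_EFinP; exact: measurable_indic.
  rewrite (ge0_integralZl mu mT m4) ?lee_fin // (integral_indic mu mT mI) setIT.
  by rewrite -[X in (_ * X)%E]/(mu I01) mu_I01 mule1.
rewrite -(ge0_integralD mu mT p2 m2 p3 m3); have p1 x : setT x -> (0 <= slice f y s x)%E by move=> _; exact: slice_ge0.
apply: (@ge0_le_integral _ _ _ mu _ mT _ _ p1 m1 (emeasurable_funD m2 m3)).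
move=> x _; have [Ix|Ix] := pselect (I01 x); last first.
  by rewrite !slice_out // add0e mule_ge0 ?lee_fin.
rewrite !slice_in // indicE mem_set // mule1.
have scale w c : c != 0 -> law (fun t => c * w t) (above s) = law w (above (s / `|c|)).
  move=> c0; rewrite /law; congr (mu _); apply/seteqP; split => t [It ht]; split => //; move: ht;
    by rewrite /above /= normrM ltr_pdivrMr ?normr_gt0 // mulrC.
have [->|c0] := eqVneq (f x) 0.
  have E w : law (fun t => 0 * w t) (above s) = 0%E.
    rewrite /law -(measure0 mu); congr (mu _); apply/seteqP; split => // t [_].
    by rewrite /above /= mul0r normr0 ltNge s0.
  by rewrite !E add0e lee_fin.
by rewrite !scale //; apply: h; rewrite divr_ge0.
Qed.

End ProductDistribution.

(** * Decreasing rearrangements *)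

Section Rearrangement.
Variable R : realType.
Local Notation mu := (@lebesgue_measure R).
Implicit Types (x y f g u v : R -> R) (c d e r s t M : R) (k m n : nat).
Implicit Types (D : R -> \bar R).

(** Written in terms of a distribution alone, to serve functions on the interval and on the square
    alike. *)
Definition rearr D : R -> R := fun t => inf [set s : R | 0 <= s /\ (D s <= t%:E)%E].

Lemma rearr2E (h : R * R -> R) : rearr2 h = rearr (distr2 h).
Proof. by []. Qed.

(** Makes the set under [inf] nonempty for every positive [t]. On the empty set [inf] has the
    default value 0, which would break monotonicity; at [t = 0] this can still happen. *)
Definition vanishing D := forall t, 0 < t -> exists s, 0 <= s /\ (D s <= t%:E)%E.

Lemma rearr_lbound D t : has_lbound [set s : R | 0 <= s /\ (D s <= t%:E)%E].
Proof. by exists 0 => s []. Qed.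

Lemma rearr_le D s t : 0 <= s -> (D s <= t%:E)%E -> rearr D t <= s.
Proof. by move=> s0 Ds; apply: ge_inf; [exact: rearr_lbound|split]. Qed.

Lemma rearr_ge0 D t : 0 <= rearr D t.
Proof.
rewrite /rearr; set S := [set _ | _].
have [[s Ss]|nS] := pselect (S !=set0).
  by apply: lb_le_inf; [exists s|move=> r []].
have -> : S = set0 by apply/seteqP; split => // s Ss; apply: nS; exists s.
by rewrite inf0.
Qed.

Lemma rearr_mono D1 D2 t1 t2 : vanishing D1 -> 0 < t1 -> t1 <= t2 ->
  (forall s, 0 <= s -> (D2 s <= D1 s)%E) -> rearr D2 t2 <= rearr D1 t1.
Proof.
move=> v t0 tt h; apply: lb_le_inf; first by have [s hs] := v _ t0; exists s.
by move=> s [s0 Ds]; apply: rearr_le => //; apply: le_trans (h s s0) (le_trans Ds _); rewrite lee_fin.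
Qed.

(** On []0, 1]] the function is nonincreasing, so preimages of half-lines are intervals. The
    exceptional point 0 is dropped beforehand. *)
Lemma measurable_rearr D : vanishing D -> measurable_fun I01 (rearr D).
Proof.
move=> v; rewrite /I01; apply/measurable_fun_itv_obnd_cbndP.
have mO : measurable (`]0, 1]%classic : set R) by exact: measurable_itv.
move=> _; apply: (measurability (@RGenOInfty.G R)); first exact: RGenOInfty.measurableE.
move=> /= _ [_] [r] -> <-.
apply: is_interval_measurable => s t /=; rewrite !in_itv /= !andbT.
move=> [/andP[s0 s1] rs] [/andP[t0 t1] rt] p /andP[sp pt]; rewrite !in_itv /= andbT.
have p0 : 0 < p := lt_le_trans s0 sp.
split; first by rewrite p0 (le_trans pt).
by apply: lt_le_trans rt _; exact: rearr_mono.
exact: mO.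
Qed.

Lemma law_above_mono x s1 s2 : measurable_fun I01 x -> s1 <= s2 ->
  (law x (above s2) <= law x (above s1))%E.
Proof.
move=> mx ss; apply: le_measure; rewrite ?inE.
- exact: (mx (@measurable_I01 R) _ (measurable_above s2)).
- exact: (mx (@measurable_I01 R) _ (measurable_above s1)).
by move=> t [It h]; split => //; exact: le_lt_trans ss h.
Qed.

Lemma law_above_vanishing x : measurable_fun I01 x -> vanishing (fun s => law x (above s)).
Proof.
move=> mx t t0; pose F n := I01 `&` x @^-1` above n%:R.
have mF n : measurable (F n) by exact: (mx (@measurable_I01 R) _ (measurable_above n%:R)).
have F0 : \bigcap_n F n = set0.
  apply/seteqP; split => // p hp; have [n _ hn] := nbhs_infty_gtr (`|x p|).
  by have [_] := hp n I; rewrite /above /= ltNge (ltW (hn n _)) /=.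
have fin : (mu (F 0%N) < +oo)%E.
  by apply: le_lt_trans (law_le1 mx (measurable_above _)) _; rewrite ltey.
have mb : measurable (\bigcap_n F n) by rewrite F0; exact: measurable0.
have ni : nonincreasing_seq F.
  by move=> m n mn; apply/subsetPset => p [Ip h]; split => //; apply: le_lt_trans h; rewrite ler_nat.
have := @nonincreasing_cvg_mu _ _ _ mu _ fin mF mb ni; rewrite F0 measure0.
move=> /fine_cvgP[_ /cvgrPdist_lt /(_ _ t0) [n _ /(_ n (leqnn n))]] /=.
rewrite sub0r normrN => h; exists n%:R; split => //.
rewrite -[law _ _]fineK ?lee_fin; last exact: law_fin (measurable_above _).
by apply: ltW; apply: le_lt_trans h; exact: ler_norm.
Qed.

Lemma law_above_rcont x s t : measurable_fun I01 x ->
  (forall e, 0 < e -> (law x (above (s + e)) <= t%:E)%E) -> (law x (above s) <= t%:E)%E.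
Proof.
move=> mx h; pose F n := I01 `&` x @^-1` above (s + n.+1%:R^-1).
have mF n : measurable (F n) by exact: (mx (@measurable_I01 R) _ (measurable_above _)).
have E : \bigcup_n F n = I01 `&` x @^-1` above s.
  apply/seteqP; split => [p [n _ [Ip hp]]|p [Ip hp]].
    by split => //; apply: lt_trans hp; rewrite ltrDl invr_gt0.
  have d0 : 0 < `|x p| - s by rewrite subr_gt0.
  have [n _ hn] := near_infty_natSinv_lt (PosNum d0).
  by exists n => //; split => //; have := hn n (leqnn n); rewrite /above /= ltrBrDl.
have mb : measurable (\bigcup_n F n) by exact: bigcup_measurable.
have nd : nondecreasing_seq F.
  move=> m n mn; apply/subsetPset => p [Ip hp]; split => //; apply: le_lt_trans hp.
  by rewrite lerD2l lef_pV2 ?posrE ?ltr0n // ler_nat.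
have cv := @nondecreasing_cvg_mu _ _ _ mu _ mF mb nd.
rewrite /law -E -(cvg_lim _ cv) //; apply: lime_le; first by apply/cvg_ex; eexists; exact: cv.
by apply: nearW => n; apply: h; rewrite invr_gt0.
Qed.

(** Right continuity of the distribution means that the infimum defining the rearrangement is
    attained. *)
Lemma lt_rearr x s t : measurable_fun I01 x -> 0 <= s -> 0 < t ->
  (s < rearr (fun r => law x (above r)) t) = (t%:E < law x (above s))%E.
Proof.
move=> mx s0 t0; apply/idP/idP.
  by rewrite !ltNge; apply: contra => h; exact: rearr_le.
rewrite !ltNge; apply: contra => h; apply: le_trans (law_above_mono mx h) _.
apply: law_above_rcont => // e e0.
have hi : has_inf [set s : R | 0 <= s /\ (law x (above s) <= t%:E)%E].
  split; last exact: rearr_lbound.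
  by have [r hr] := law_above_vanishing mx t0; exists r.
have [r [r0 hr] re] := inf_adherent e0 hi.
by apply: le_trans (law_above_mono mx (ltW re)) hr.
Qed.

(** For [s >= 0] the rearrangement exceeds [s] exactly on []0, d[], up to the point 0, where [d] is
    the measure of the set where [|x| > s]. For [s < 0] both sets are the whole interval. *)
Lemma rearr_equimeasurable x : measurable_fun I01 x ->
  equimeasurable (rearr (fun r => law x (above r))) (fun t => `|x t|).
Proof.
move=> mx s; rewrite distr1_abs; set g := rearr _.
have mg : measurable_fun I01 g by apply: measurable_rearr; exact: law_above_vanishing.
have [s0|s0] := ltP s 0.
  rewrite /distr1; transitivity (mu I01).
    congr (mu _); apply/seteqP; split => [t []//|t It]; split => //.
    by apply: lt_le_trans s0 (rearr_ge0 _ _).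
  congr (mu _); apply/seteqP; split => [t It|t []//]; split => //.
  by rewrite /preimage /=; apply: lt_le_trans s0 (normr_ge0 _).
have fD := law_fin mx (measurable_above s).
have := law_ge0 x (above s); have := law_le1 mx (measurable_above s).
rewrite -[LHS]/(distr1 g s) -/(above s); case E : (law x (above s)) fD => [d| |] // _.
rewrite !lee_fin => d1 d0; transitivity (mu `]0, d[%classic); last first.
  rewrite lebesgue_measure_itv /= lte_fin; case: ltP => [_|]; first by rewrite sube0.
  by move=> ?; congr EFin; lra.
rewrite law_distr1; apply: ae_measure_eq.
- exact: (mg (@measurable_I01 R) _ (measurable_itv _)).
- exact: measurable_itv.
apply: ae_imp _ (ae_ne 0) => t t0; rewrite /I01 /= !in_itv /= andbT; split.
  move=> [/andP[h0 h1]]; have tp : 0 < t by rewrite lt_def t0.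
  by rewrite /g lt_rearr // E lte_fin tp.
move=> /andP[tp td]; split; first by apply/andP; split; lra.
by rewrite /g lt_rearr // E lte_fin.
Qed.

End Rearrangement.

(** * Multiplicators tested on step functions, and the dominating staircase *)

Section Multiplicator.
Variables (R : realType) (X : symspace R).
Local Notation mu := (@lebesgue_measure R).
Local Notation mem := (ss_mem X).
Local Notation N := (ss_norm X).
Implicit Types (x y f g u v : R -> R) (C d e r s t M : R) (j k m n : nat).
Implicit Types (xi : seq bool -> R) (c : nat -> R).

(** Condition (M), with [y = blk chi01 xi k] and [y * f_k = blk f xi k]. *)
Definition step_multiplicator f := exists C, 0 <= C /\
  forall k xi, N (blk f xi k) <= C * N (blk chi01 xi k).

Lemma mem_abs x : mem x -> mem (fun t => `|x t|).
Proof.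
move=> mx; have mmx := ss_meas mx; apply: (mem_dom mx); first exact: measurableT_comp.
by apply: aeW => t _; rewrite normr_id.
Qed.

Lemma norm_abs x : mem x -> N (fun t => `|x t|) = N x.
Proof.
move=> mx; have mmx := ss_meas mx; have ma := mem_abs mx; apply/eqP; rewrite eq_le; apply/andP; split.
  by apply: (norm_dom mx); [exact: ss_meas ma|apply: aeW => t _; rewrite normr_id].
by apply: (norm_dom ma) => //; apply: aeW => t _; rewrite normr_id.
Qed.

Lemma mem_rearr x : mem x -> mem (rearr (fun r => law x (above r))).
Proof.
move=> mx; have mmx := ss_meas mx.
have mr := measurable_rearr (law_above_vanishing mmx).
by have [] := ss_sym (mem_abs mx) mr (rearr_equimeasurable mmx).
Qed.

Lemma norm_rearr x : mem x -> N (rearr (fun r => law x (above r))) = N x.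
Proof.
move=> mx; have mmx := ss_meas mx.
have mr := measurable_rearr (law_above_vanishing mmx).
have [_ ->] := ss_sym (mem_abs mx) mr (rearr_equimeasurable mmx).
exact: norm_abs.
Qed.

Lemma multiplicator_step f : mem f -> multiplicator X f -> step_multiplicator f.
Proof.
move=> mf [_ [C hC]]; exists `|C|; split => // k xi.
have mB := mem_blk xi k mf; have mS := mem_step X xi k.
have [_ [_]] := hC _ mS; rewrite rearr2E.
rewrite (_ : distr2 _ = fun r => law (blk f xi k) (above r)); last first.
  by apply/funext => s; apply: distr2_step; exact: ss_meas mf.
rewrite norm_rearr // => h; apply: le_trans h _.
by rewrite ler_wpM2r ?ler_norm // ss_norm_ge0.
Qed.

(* [stair c f n] is [\sum_(j < n) c j * V0^j (V1 f)]: it carries a copy of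
   [c j * f] on the interval [(2^-(j+1), 2^-j)]. *)
Fixpoint stair c f n : R -> R :=
  if n is n'.+1 then join (stair (fun j => c j.+1) f n') (fun t => c 0%N * f t) else fun=> 0.

(** A word with [j] zeros before its first one gets [c j], the word of [n] zeros gets 0. *)
Fixpoint stair_coef c n (a : seq bool) : R :=
  match n, a with
  | n'.+1, b :: a' => if b then c 0%N else stair_coef (fun j => c j.+1) n' a'
  | _, _ => 0
  end.

Lemma mem_stair c f n : mem f -> mem (stair c f n).
Proof.
move=> mf; elim: n c => [|n IH] c /=; first exact: ss_mem0.
by apply: mem_join; [exact: IH|exact: ss_memZ].
Qed.

(** Only the laws agree: on [(2^-(j+1), 2^-j)] the staircase has one copy of [c j * f], the block
    has [2^(n-j-1)] shorter ones. *)
Lemma stair_equi c f n : mem f -> equi (stair c f n) (blk f (stair_coef c n) n).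
Proof.
move=> mf; elim: n c => [|n IH] c.
  by apply: aeq_equi; [exact: ss_meas (ss_mem0 X)|apply: measurable_blk; exact: ss_meas mf|
    apply: aeW => t _; rewrite /blk /= mul0r].
move=> B mB; rewrite blkS /= law_join //; [|exact: ss_meas (mem_stair _ _ mf)|exact: ss_meas (ss_memZ _ mf)].
rewrite law_join //; [|exact: ss_meas (mem_blk _ _ mf)|exact: ss_meas (mem_blk _ _ mf)].
congr (_ * (_ + _))%E; first exact: IH.
by apply/esym; apply: (equi_tree_const _ _ mB); exact: ss_meas (ss_memZ _ mf).
Qed.

Lemma stair_linB c1 c2 f n : stair (fun j => c1 j - c2 j) f n = stair c1 f n \- stair c2 f n.
Proof.
elim: n c1 c2 => [|n IH] c1 c2 /=; first by apply/funext => t /=; rewrite subrr.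
rewrite IH; apply/funext => t; rewrite /join /V0 /V1 /=.
by case: ifP => _; case: ifP => _; ring.
Qed.

Lemma stair0 f m : stair (fun=> 0) f m = fun=> 0.
Proof.
elim: m => [//|m IH] /=; rewrite IH; apply/funext => t; rewrite /join /V0 /V1 /=.
by case: ifP => _; case: ifP => _; rewrite ?mul0r ?addr0.
Qed.

Lemma stair_trunc c f m n : (n <= m)%N ->
  stair (fun j => if (j < n)%N then c j else 0) f m = stair c f n.
Proof.
elim: n m c => [|n IH] m c; first by move=> _; exact: stair0.
by case: m => [//|m] nm /=; congr join; exact: IH.
Qed.

Definition tail c n j := if (n <= j)%N then c j else 0.

Lemma stair_tail c f m n : (n <= m)%N -> stair (tail c n) f m = stair c f m \- stair c f n.
Proof.
move=> nm; rewrite -(stair_trunc c f nm) -stair_linB; congr (stair _ f m).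
by apply/funext => j; rewrite /tail ltnNge; case: leqP => _; rewrite ?subr0 ?subrr.
Qed.

(** Compares a juxtaposition with the two halves of an arbitrary [g]. As [T] is arbitrary, [g] may
    also return [t], which lets [P] mention the position. *)
Lemma join_ae_rel T (P : R -> T -> Prop) u v (g : R -> T) :
  {ae mu, forall t, I01 t -> t < 1 -> P (u t) (g (t / 2))} ->
  {ae mu, forall t, I01 t -> 0 < t -> P (v t) (g ((t + 1) / 2))} ->
  {ae mu, forall t, I01 t -> P (join u v t) (g t)}.
Proof.
move=> /(ae_affine 0) hu /(ae_affine 1) hv.
apply: ae_imp3 _ hu hv (ae_ne 2^-1) => t hu hv t2.
rewrite subr0 /I01 /= !in_itv /= in hu hv * => /andP[t0 t1].
have E0 : 2 * t / 2 = t by field.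
have E1 : (2 * t - 1 + 1) / 2 = t by field.
rewrite E0 in hu; rewrite E1 in hv.
have [lt|gt|/eqP] := ltgtP t 2^-1; last by rewrite (negPf t2).
  by rewrite joinl ?t0 //; apply: hu; [apply/andP; split|]; lra.
by rewrite joinr ?t1 ?gt //; apply: hv; [apply/andP; split|]; lra.
Qed.

Lemma halfpowS j : 2 ^- j.+1 = 2 ^- j / 2 :> R.
Proof. by rewrite exprSr invfM. Qed.

(** Induction on the number of steps: on the left half, [g] is replaced by [t -> g (t / 2)] and [c]
    is shifted. *)
Lemma stair_le c g n : (forall j t, 0 < t -> t <= 2 ^- j -> `|c j| <= g t) ->
  {ae mu, forall t, I01 t -> `|stair c chi01 n t| <= g t}.
Proof.
elim: n c g => [|n IH] c g h.
  apply: ae_imp _ (ae_ne 0) => t t0; rewrite /I01 /= in_itv /= => /andP[h0 h1].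
  rewrite normr0; apply: le_trans (normr_ge0 _) (h 0%N t _ _); first by rewrite lt_def t0.
  by rewrite expr0 invr1.
apply: (@join_ae_rel _ (fun p q => `|p| <= q)).
  have hS j t : 0 < t -> t <= 2 ^- j -> `|c j.+1| <= g (t / 2).
    by move=> t0 tj; apply: h; [rewrite divr_gt0|rewrite halfpowS ler_pM2r ?invr_gt0].
  by apply: ae_imp _ (IH _ (fun t => g (t / 2)) hS) => t ht It _; exact: ht.
apply: aeW => t It t0; rewrite chi01E // mulr1; apply: h.
  by rewrite divr_gt0 // addr_gt0.
by move: It; rewrite expr0 invr1 /I01 /= in_itv /= => /andP[_ t1]; lra.
Qed.

Lemma stair_ge c g n : (forall j t, 2 ^- j.+1 < t -> t <= 2 ^- j -> g t <= c j) ->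
  {ae mu, forall t, I01 t -> 2 ^- n < t -> g t <= stair c chi01 n t}.
Proof.
elim: n c g => [|n IH] c g h.
  by apply: aeW => t; rewrite /I01 /= in_itv /= expr0 invr1 => /andP[_ t1]; rewrite ltNge t1.
apply: (@join_ae_rel _ (fun p q => 2 ^- n.+1 < q.1 -> q.2 <= p) _ _ (fun t => (t, g t))).
  have hS j t : 2 ^- j.+1 < t -> t <= 2 ^- j -> g (t / 2) <= c j.+1.
    by move=> t0 tj; apply: h; rewrite halfpowS ?ltr_pM2r ?ler_pM2r ?invr_gt0.
  apply: ae_imp _ (IH _ (fun t => g (t / 2)) hS) => t ht It _ /=.
  by rewrite halfpowS ltr_pM2r ?invr_gt0 //; exact: ht.
apply: aeW => t It t0 /= _; rewrite chi01E // mulr1; apply: h.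
  by rewrite expr1; lra.
by move: It; rewrite expr0 invr1 /I01 /= in_itv /= => /andP[_ t1]; lra.
Qed.

Lemma stair_tail_eq0 c f n m :
  {ae mu, forall t, I01 t -> 2 ^- n < t -> stair (tail c n) f m t = 0}.
Proof.
elim: m n c => [|m IH] n c; first exact: aeW.
case: n => [|n].
  by apply: aeW => t; rewrite /I01 /= in_itv /= expr0 invr1 => /andP[_ t1]; rewrite ltNge t1.
apply: (@join_ae_rel _ (fun p q => 2 ^- n.+1 < q -> p = 0) _ _ id).
  apply: ae_imp _ (IH n (fun j => c j.+1)) => t ht It _.
  by rewrite halfpowS ltr_pM2r ?invr_gt0 //; exact: ht.
by apply: aeW => t _ _ _; rewrite /tail mul0r.
Qed.

Section Dominating.
Hypothesis sepX : separable X.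
Variables (f y : R -> R) (C : R).
Hypotheses (mf : mem f) (my : mem y) (C0 : 0 <= C).
Hypothesis hC : forall k xi, N (blk f xi k) <= C * N (blk chi01 xi k).

Let ystar := rearr (fun r => law y (above r)).
(** The largest value of [ystar] on [(2^-(j+1), 2^-j]], up to the left endpoint where it is taken.
    The staircase thus lies above [ystar], and below [sigma] because [t / 2 <= 2^-(j+1)] there. *)
Let c j := ystar (2 ^- j.+1).
Let sigma t := ystar (t / 2).

Let ystar_mono s t : 0 < s -> s <= t -> ystar t <= ystar s.
Proof. by move=> s0 st; apply: rearr_mono => //; apply: law_above_vanishing; exact: ss_meas my. Qed.

Let mem_ystar : mem ystar. Proof. exact: mem_rearr. Qed.

Let measurable_sigma : measurable_fun I01 sigma.
Proof.
have s : (fun t => t / 2) @` I01 `<=` (I01 : set R).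
  by move=> _ [t /= + <-]; rewrite /I01 /= !in_itv /= => /andP[? ?]; apply/andP; split; lra.
have m2 : measurable_fun I01 (fun t : R => t / 2).
  by apply: measurable_funTS; exact: mulrr_measurable.
exact: (measurable_comp (@measurable_I01 R) s (ss_meas mem_ystar) m2).
Qed.

(** [V0 sigma] is the restriction of [ystar] to [[0, 1/2]]; [V0_dilation] supplies the factor 2. *)
Let sigma_bound : mem sigma /\ N sigma <= 2 * N y.
Proof.
have mV0 := measurable_V0 measurable_sigma.
have leV : {ae mu, forall t, I01 t -> `|V0 sigma t| <= `|ystar t|}.
  apply: aeW => t _; rewrite /V0; case: ifP => _; last by rewrite normr0.
  by rewrite /sigma mulrC mulKf ?pnatr_eq0.
have m0 := mem_dom mem_ystar mV0 leV; have n0 := norm_dom mem_ystar mV0 leV.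
have [ms ns] := V0_dilation measurable_sigma m0; split => //.
by apply: le_trans ns _; rewrite ler_pM2l // -(norm_rearr my).
Qed.

Let mem_sigma : mem sigma. Proof. exact: sigma_bound.1. Qed.

Let h n := stair c f n.

Let norm_stair c' m : N (stair c' f m) <= C * N (stair c' chi01 m).
Proof.
have mB := mem_blk (stair_coef c' m) m mf; have mS := mem_step X (stair_coef c' m) m.
have e1 := stair_equi c' m mf; have e2 := stair_equi c' m (ss_mem1 X).
rewrite (norm_equi mB (ss_meas (mem_stair _ _ mf)) e1).
by rewrite (norm_equi mS (ss_meas (mem_stair _ _ (ss_mem1 X))) e2); exact: hC.
Qed.

Let c_le j t : 0 < t -> t <= 2 ^- j -> `|c j| <= sigma t.
Proof.
move=> t0 tj; rewrite ger0_norm; last exact: rearr_ge0.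
by apply: ystar_mono; [rewrite divr_gt0|rewrite halfpowS ler_pM2r ?invr_gt0].
Qed.

Let norm_h n : N (h n) <= 2 * C * N y.
Proof.
have le : N (stair c chi01 n) <= N sigma.
  apply: (norm_dom mem_sigma); first exact: ss_meas (mem_stair _ _ (ss_mem1 X)).
  by apply: ae_imp _ (stair_le n c_le) => t ht It; apply: le_trans (ht It) (ler_norm _).
apply: le_trans (norm_stair c n) _; rewrite (mulrC 2) -mulrA ler_wpM2l //.
by apply: le_trans le _; exact: sigma_bound.2.
Qed.

(** The difference of two staircases is a staircase supported near 0. By (M) its norm is at most [C]
    times that of [sigma] cut to [t <= 2^-n], which tends to 0. *)
Let cv : exists w, mem w /\ (fun n => N (w \- h n)) @ \oo --> (0 : R).
Proof.
have mh n : mem (h n) by exact: mem_stair.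
pose A n : set R := `]-oo, 2 ^- n]%classic.
have mA n : measurable (A n) by exact: measurable_itv.
have small e : 0 < e -> exists n, forall m, (n <= m)%N -> N (cut (A m) sigma) < e.
  apply: abs_continuity => //.
  - move=> n t; rewrite /A /= !in_itv /= => ht; apply: le_trans ht _.
    by rewrite halfpowS ler_pdivrMr // ler_pMr ?ler1n // invr_gt0 exprn_gt0.
  - apply: ae_imp _ (ae_ne 0) => t t0; rewrite /I01 /= in_itv /= => /andP[h0 _].
    have {}t0 : 0 < t by rewrite lt_def t0.
    have [n hn] := half_pow_small t0; exists n; rewrite /A /= in_itv /= leNgt.
    by rewrite hn.
have diff n m : (n <= m)%N -> N (h m \- h n) <= C * N (cut (A n) sigma).
  move=> nm; rewrite /h -(stair_tail c f nm); apply: le_trans (norm_stair _ _) _.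
  rewrite ler_wpM2l //; apply: norm_dom; first exact: mem_cut.
    exact: ss_meas (mem_stair _ _ (ss_mem1 X)).
  have H j t : 0 < t -> t <= 2 ^- j -> `|tail c n j| <= cut (A n) sigma t.
    move=> t0 tj; rewrite /tail; case: leqP => nj; last first.
      by rewrite normr0 /cut mulr_ge0 // rearr_ge0.
    rewrite cut_in; first exact: c_le.
    rewrite /A /= in_itv /=; apply: le_trans tj _.
    by rewrite lef_pV2 ?posrE ?exprn_gt0 // ler_eXn2l // ltr1n.
  by apply: ae_imp _ (stair_le m H) => t ht It; apply: le_trans (ht It) (ler_norm _).
apply: ss_complete => // e e0.
have C1 : 0 < C + 1 by rewrite ltr_wpDl.
have [n hn] := small (e / (C + 1)) (divr_gt0 e0 C1); exists n.
have H i j : (n <= i)%N -> (i <= j)%N -> N (h j \- h i) < e.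
  move=> ni ij; apply: le_lt_trans (diff i j ij) _.
  have := hn i ni; rewrite ltr_pdivlMr //; have := ss_norm_ge0 (mem_cut (mA i) mem_sigma); lra.
move=> i j ni nj; have [ij|/ltnW ji] := leqP i j; last exact: H.
by rewrite norm_subC //; exact: H.
Qed.

(** The rearrangement of the tensor product is below that of the limit [w] of the staircases, and
    [w] inherits the bound [2 * C * N y] from [norm_h]. *)
Lemma rearr2_tensor_bound : [/\ measurable_fun I2 (tensor f y),
  mem (rearr2 (tensor f y)) & N (rearr2 (tensor f y)) <= 2 * C * N y].
Proof.
have mmf := ss_meas mf; have mmy := ss_meas my.
have [w [mw wcv]] := cv; have mmw := ss_meas mw.
have mh n : mem (h n) by exact: mem_stair.
(* Beyond [2^-n] all later staircases coincide with [h n], so the limit does too. *)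
have wh n : {ae mu, forall t, I01 t -> 2 ^- n < t -> w t = h n t}.
  pose A : set R := `]2 ^- n, +oo[%classic.
  have mA : measurable A by exact: measurable_itv.
  have mc : mem (cut A (w \- h n)) by apply: mem_cut => //; exact: memB.
  suff : {ae mu, forall t, I01 t -> cut A (w \- h n) t = 0}.
    apply: ae_imp => t ht It tn; have := ht It; rewrite cut_in /=; last by rewrite /A /= in_itv /= tn.
    by move/eqP; rewrite subr_eq0 => /eqP.
  apply/(ss_norm_eq0 mc).1/eqP; rewrite eq_le ss_norm_ge0 // andbT.
  apply/ler_addgt0Pr => e e0; rewrite add0r; have [m hm] := cvg_norm_eps wcv e0.
  pose p := maxn n m; apply: le_trans (ltW (hm p (leq_maxr n m))).
  rewrite (_ : N (cut A (w \- h n)) = N (cut A (w \- h p))); last first.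
    apply: norm_aeq => //; first by apply: mem_cut => //; exact: memB.
    apply: ae_imp _ (stair_tail_eq0 c f n p) => t ht It.
    have [At|At] := pselect (A t); last by rewrite !cut_notin.
    rewrite !cut_in //=; have := ht It; rewrite stair_tail ?leq_maxl //.
    move: At; rewrite /A /= in_itv /= andbT => /[swap] /[apply] /eqP.
    by rewrite subr_eq0 => /eqP E; rewrite /h -E.
  by apply: norm_cut => //; exact: memB.
have law_close (x z : R -> R) n : measurable_fun I01 x -> measurable_fun I01 z ->
    {ae mu, forall t, I01 t -> 2 ^- n < t -> `|x t| <= `|z t|} ->
    forall s, (law x (above s) <= law z (above s) + (2 ^- n)%:E)%E.
  move=> mx mz [Z [mZ Z0 sZ]] s.
  have mB : measurable (`[0, 2 ^- n]%classic : set R) by exact: measurable_itv.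
  have mX := mx (@measurable_I01 R) _ (measurable_above s).
  have mZs := mz (@measurable_I01 R) _ (measurable_above s).
  have <- : mu `[0, 2 ^- n]%classic = (2 ^- n)%:E.
    by rewrite lebesgue_measure_itv /= lte_fin invr_gt0 exprn_gt0 // sube0.
  have mU := measurableU _ _ mZs mB.
  pose A : set R := I01 `&` z @^-1` above s; pose B : set R := `[0, 2 ^- n]%classic.
  have E : mu (A `|` B `|` Z) = mu (A `|` B) := @measureU0 _ _ _ mu _ _ mU mZ Z0.
  have U : (mu (A `|` B) <= mu A + mu B)%E := measureU2 mu mZs mB.
  suff le : (law x (above s) <= mu (A `|` B `|` Z))%E by apply: le_trans le _; rewrite E.
  apply: le_measure; rewrite ?inE //; first exact: (measurableU _ _ mU mZ).
  move=> t [It hx]; have [tn|tn] := leP t (2 ^- n).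
    by left; right; move: It; rewrite /B /I01 /= !in_itv /= => /andP[-> _].
  have [hz|hz] := pselect (s < `|z t|); first by left; left.
  by right; apply: sZ => /= /(_ It tn) le; apply: hz; exact: lt_le_trans hx le.
(* Up to measure [2^-n], [y] has a smaller distribution than the step function; the latter times [f]
   has the law of a block, hence of [h n]; and [h n] equals [w] up to measure [2^-n]. The two errors
   add up to less than [e]. *)
have key s : 0 <= s -> (distr2 (tensor f y) s <= law w (above s))%E.
  move=> s0; apply/lee_addgt0Pr => e e0.
  have [n /(_ n (leqnn n)) hn] := half_pow_small (divr_gt0 e0 (ltr0Sn R 1)).
  have mst g : mem g -> measurable_fun I01 (stair c g n) by move=> mg; exact: ss_meas (mem_stair _ _ mg).
  have h1 s' : 0 <= s' -> (law y (above s') <= law (blk chi01 (stair_coef c n) n) (above s') + (2 ^- n)%:E)%E.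
    move=> s0'; rewrite -(stair_equi c n (ss_mem1 X) (measurable_above s')).
    have -> : law y (above s') = law ystar (above s').
      rewrite -!distr1_abs -(rearr_equimeasurable mmy s'); apply/esym.
      congr (lebesgue_measure _); apply/seteqP; split => t [It ht]; split => //; move: ht;
        by rewrite ger0_norm ?rearr_ge0.
    apply: law_close; [exact: ss_meas mem_ystar|exact: mst (ss_mem1 X)|].
    have H j t : 2 ^- j.+1 < t -> t <= 2 ^- j -> ystar t <= c j.
      by move=> tj _; apply: ystar_mono (ltW tj); rewrite invr_gt0 exprn_gt0.
    apply: ae_imp _ (stair_ge n H) => t ht It tn.
    rewrite ger0_norm; last exact: rearr_ge0.
    by apply: le_trans (ht It tn) (ler_norm _).
  have p0 : 0 <= 2 ^- n :> R by rewrite invr_ge0 exprn_ge0.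
  have mS := measurable_blk (stair_coef c n) n (@measurable_chi01 R).
  apply: le_trans (distr2_le p0 mmf mmy mS h1 s0) _.
  rewrite distr2_step // -(stair_equi c n mf (measurable_above s)).
  apply: (@le_trans _ _ (law w (above s) + (2 ^- n)%:E + (2 ^- n)%:E)%E).
    apply: leeD => //; apply: law_close => //; first exact: mst.
    by apply: ae_imp _ (wh n) => t ht It tn; rewrite (ht It tn).
  rewrite -addeA leeD2l // -EFinD lee_fin; move: hn; move: (2 ^- n) => q; lra.
have mr := mem_rearr mw.
have van : vanishing (distr2 (tensor f y)).
  move=> t t0; have [s [s0 hs]] := law_above_vanishing mmw t0.
  by exists s; split => //; apply: le_trans (key s s0) hs.
have mG : measurable_fun I01 (rearr2 (tensor f y)) by rewrite rearr2E; exact: measurable_rearr.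
have le : {ae mu, forall t, I01 t -> `|rearr2 (tensor f y) t| <= `|rearr (fun r => law w (above r)) t|}.
  apply: ae_imp _ (ae_ne 0) => t t0; rewrite /I01 /= in_itv /= => /andP[h0 _].
  rewrite rearr2E !ger0_norm ?rearr_ge0 //; apply: rearr_mono => //.
    exact: law_above_vanishing.
  by rewrite lt_def t0.
split; [exact: measurable_tensor|exact: mem_dom mr mG le|].
apply: le_trans (norm_dom mr mG le) _; rewrite norm_rearr //.
apply/ler_addgt0Pr => e e0; have [n /(_ n (leqnn n)) hn] := cvg_norm_eps wcv e0.
have := norm_triD mw (mh n); have := norm_h n; lra.
Qed.

End Dominating.

Lemma step_multiplicator_multiplicator f : separable X -> mem f ->
  step_multiplicator f -> multiplicator X f.
Proof.
move=> sepX mf [C [C0 hC]]; split; first exact: ss_meas mf.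
by exists (2 * C) => y my; have [] := rearr2_tensor_bound sepX mf my C0 hC.
Qed.

End Multiplicator.

(** * A weak law of large numbers for dyadic step functions *)

Section LawOfLargeNumbers.
Variable R : realType.
Local Notation mu := (@lebesgue_measure R).
Implicit Types (x y f g u v : R -> R) (C d e r s t M G : R) (j k m n p : nat).
Implicit Types (xi eta gam sig : seq bool -> R).

Lemma avg_split (F : seq bool -> seq bool -> R) k m :
  avg (fun a => F (take k a) (drop k a)) (k + m) = avg (fun a => avg (F a) m) k.
Proof.
rewrite avg_cat; apply: eq_avg => a ak; apply: eq_avg => b _.
by rewrite take_size_cat // drop_size_cat.
Qed.

Lemma avg_take xi k m : avg (fun a => xi (take k a)) (k + m) = avg xi k.
Proof.
rewrite (avg_split (fun a _ => xi a)); apply: eq_avg => a _; exact: avg_const.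
Qed.

(** A step function seen at a finer level; equality can fail at dyadic points, where the halves of
    [join] overlap. *)
Lemma blk_chi_take xi k m :
  aeq (blk chi01 (fun a => xi (take k a)) (k + m)) (blk chi01 xi k).
Proof.
rewrite /blk tree_cat /aeq.
apply: (@tree_rel2 R (@eq R)) => a ak.
rewrite (@eq_tree _ _ (fun=> (fun t => xi a * chi01 t))); last first.
  by move=> b _; rewrite take_size_cat.
have h : {ae mu, forall t, I01 t -> tree (fun=> (fun t => xi a * chi01 t)) m t = xi a}.
  by apply: (@tree_rel1 _ (fun r => r = xi a)) => b _; apply: aeW => t It; rewrite chi01E // mulr1.
by apply: ae_imp _ h => t ht It; rewrite ht // chi01E // mulr1.
Qed.

(** The product of a step function of level [k] with [g (2^k t mod 1)], for [g] a step function of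
    level [p], is resolved at level [k + p]. *)
Lemma blk_blk eta gam k p :
  blk (blk chi01 gam p) eta k =
  blk chi01 (fun a => eta (take k a) * gam (drop k a)) (k + p).
Proof.
rewrite [RHS]/blk tree_cat [LHS]/blk; apply: eq_tree => a ak.
rewrite -blkZ /blk; apply: eq_tree => b _.
by rewrite take_size_cat // drop_size_cat.
Qed.

Lemma blk_linf c f g xi k : blk (fun t => c * f t + g t) xi k =
  (fun t => c * blk f xi k t + blk g xi k t).
Proof.
rewrite /blk -tree_lin; apply: eq_tree => a _; apply/funext => t; ring.
Qed.

(** Induction over [join], which averages both sides; at level 0 the function is constant. *)
Lemma chebyshev xi k d : 0 < d ->
  (mu (large (blk chi01 xi k) d) <= (avg (fun a => xi a ^+ 2) k / d ^+ 2)%:E)%E.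
Proof.
move=> d0; have mB : measurable [set r : R | d <= `|r|].
  have := @normr_measurable R setT measurableT _ (measurable_itv `[d, +oo[).
  rewrite setTI; congr (measurable _); apply/seteqP.
  by split => t /=; rewrite in_itv /= andbT.
rewrite -[mu _]/(law (blk chi01 xi k) [set r : R | d <= `|r|]).
elim: k xi => [|k IH] xi.
  have [le|lt] := leP d `|xi [::]|.
    apply: (@le_trans _ _ 1%E).
      apply: law_le1 => //; apply: measurable_blk; exact: measurable_chi01.
    rewrite lee_fin /= ler_pdivlMr ?exprn_gt0 // mul1r.
    by rewrite -(ler_sqr (x := d)) ?nnegrE ?(ltW d0) // real_normK ?num_real // in le.
  rewrite (_ : law _ _ = 0%E); first by rewrite lee_fin divr_ge0 // ?sqr_ge0.
  rewrite /law -(measure0 mu); congr (mu _); apply/seteqP; split => // t [It] /=.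
  by rewrite /blk /= chi01E // mulr1 leNgt lt.
have mS xi' := measurable_blk xi' k (@measurable_chi01 R).
rewrite blkS law_join //=.
rewrite (_ : (avg (fun a => xi (false :: a) ^+ 2) k + _) / 2 / d ^+ 2 =
  2^-1 * (avg (fun a => xi (false :: a) ^+ 2) k / d ^+ 2 + avg (fun a => xi (true :: a) ^+ 2) k / d ^+ 2)); last first.
  by ring.
rewrite EFinM EFinD; apply: lee_wpmul2l; first by rewrite lee_fin invr_ge0.
by apply: leeD; exact: IH.
Qed.

(* The step function with coefficients [eta] is multiplied by the pairwise
   orthogonal functions [g (2^k t mod 1)], where [g] is the mean-zero step
   function with coefficients [gam]; the level [k] of each new term is chosen
   beyond the resolution [K] of the sum of the previous ones, so that the second
   moments simply add up. *)
Lemma orthogonal_blocks eta gam m p M G k0 : 0 <= M -> 0 <= G ->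
  (forall a, `|eta a| <= M) -> (forall a, `|gam a| <= G) -> avg gam p = 0 ->
  (m <= k0)%N -> forall n, exists (K : nat) (eps : nat -> R) (sig : seq bool -> R),
  [/\ (k0 + n <= K)%N, (forall k, 0 <= eps k) /\ \sum_(k0 <= k < K) eps k = n%:R,
      aeq (fun t => \sum_(k0 <= k < K) eps k * blk (blk chi01 gam p) (fun a => eta (take m a)) k t)
          (blk chi01 sig K),
      (forall a, `|sig a| <= n%:R * (M * G)) &
      avg (fun a => sig a ^+ 2) K <= n%:R * (M * G) ^+ 2].
Proof.
move=> M0 G0 etaM gamG gam0 mk0; elim => [|n [K [eps [sig [kK [eps0 seps] S sigM sig2]]]]].
  exists k0, (fun=> 0), (fun=> 0); split; rewrite ?addn0 //.
  - by split => //; rewrite big1.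
  - apply: aeq_trans (_ : aeq _ (fun=> 0)) _.
      by apply: aeW => t _; rewrite big_geq.
    apply: aeq_sym; apply: (@tree_rel1 _ (fun r => r = 0)) => a _.
    by apply: aeW => t _; rewrite mul0r.
  - by move=> a; rewrite normr0 mul0r.
  - by rewrite mul0r expr0n /= avg_const.
have k0K : (k0 <= K)%N by apply: leq_trans kK; exact: leq_addr.
have mK : (m <= K)%N := leq_trans mk0 k0K.
(* The new term sits at level [K] with weight 1; the other new levels get weight 0. *)
pose eps' k := if (k < K)%N then eps k else (k == K)%:R : R.
(* The new term is resolved at level [K + p]; one more level ensures [K < K'] even for [p = 0], so
   that the level [K] enters the sum. *)
pose K' := (K + p.+1)%N; have KK' : (K <= K')%N := leq_addr _ _.
pose prod a b := eta (take m a) * gam (take p b).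
pose sig' a := sig (take K a) + prod (take K a) (drop K a).
have sumE (F : nat -> R) : \sum_(k0 <= k < K') eps' k * F k =
    \sum_(k0 <= k < K) eps k * F k + F K.
  rewrite (big_cat_nat k0K KK') /=.
  congr (_ + _).
    by apply: eq_big_nat => k /andP[_ kK']; rewrite /eps' kK'.
  rewrite big_ltn; last by rewrite /K' addnS ltnS leq_addr.
  rewrite /eps' ltnn eqxx mul1r big_nat big1 ?addr0 // => k /andP[Kk _].
  by rewrite ltnNge (ltnW Kk) /= gtn_eqF // mul0r.
exists K', eps', sig'; split.
- by rewrite /K' addnS addnS ltnS (leq_trans kK) // leq_addr.
- split; first by move=> k; rewrite /eps'; case: ifP.
  have := sumE (fun=> 1); under eq_bigr do rewrite mulr1; move=> ->.
  by under eq_bigr do rewrite mulr1; rewrite seps -natr1.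
- have E1 : aeq (blk chi01 (fun a => sig (take K a)) K') (blk chi01 sig K) := blk_chi_take sig K p.+1.
  have E2 : aeq (blk chi01 (fun a => prod (take K a) (drop K a)) K')
      (blk (blk chi01 gam p) (fun a => eta (take m a)) K).
    rewrite blk_blk; have := blk_chi_take (fun a => eta (take m (take K a)) * gam (drop K a)) (K + p) 1.
    apply: aeq_trans; rewrite addn1 -addnS.
    rewrite (@eq_blk _ _ _ (fun a => eta (take m (take K (take (K + p) a))) * gam (drop K (take (K + p) a)))); first exact: aeq_refl.
    move=> a _; rewrite /prod; congr (eta (take m _) * gam _).
      by rewrite take_takel // leq_addr.
    by rewrite take_drop addnC.
  apply: ae_imp3 _ S E1 E2 => t S E1 E2 It.
  have L : blk chi01 sig' K' = (fun t => 1 * blk chi01 (fun a => sig (take K a)) K' t +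
      blk chi01 (fun a => prod (take K a) (drop K a)) K' t).
    by rewrite -blk_lin; apply: eq_blk => a _; rewrite mul1r.
  by rewrite sumE S // L mul1r E1 // E2.
- move=> a; apply: le_trans (ler_normD _ _) _; rewrite -natr1 mulrDl mul1r.
  by apply: lerD => //; rewrite normrM ler_pM.
- rewrite /sig' /K' (avg_split (fun a b => (sig a + prod a b) ^+ 2)).
  have g1 : avg (fun b => gam (take p b)) p.+1 = 0 by rewrite -addn1 avg_take.
  apply: le_trans (_ : avg (fun a => 1 * sig a ^+ 2 + (M * G) ^+ 2) K <= _); last first.
    by rewrite avg_lin mul1r avg_const -natr1 mulrDl mul1r lerD2r.
  apply: ler_avg => a _.
  (* Orthogonality: for fixed [a] the cross term is a multiple of the mean of [gam], which is 0. *)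
  have -> : avg (fun b => (sig a + prod a b) ^+ 2) p.+1 =
      sig a ^+ 2 + avg (fun b => prod a b ^+ 2) p.+1.
    transitivity (avg (fun b => 1 * (sig a ^+ 2 + 2 * sig a * eta (take m a) * gam (take p b)) + prod a b ^+ 2) p.+1).
      by apply: eq_avg => b _; rewrite /prod; ring.
    rewrite avg_lin mul1r; congr (_ + _).
    transitivity (avg (fun b => (2 * sig a * eta (take m a)) * gam (take p b) + sig a ^+ 2) p.+1).
      by apply: eq_avg => b _; rewrite addrC.
    by rewrite avg_lin avg_const g1 mulr0 add0r.
  rewrite mul1r lerD2l -(avg_const ((M * G) ^+ 2) p.+1); apply: ler_avg => b _.
  rewrite -[leLHS]real_normK ?num_real // ler_sqr ?nnegrE ?mulr_ge0 //.
  by rewrite /prod normrM ler_pM.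
Qed.

End LawOfLargeNumbers.

(** * From the inequality (M) to expansions in blocks *)

Section Representation.
Variables (R : realType) (X : symspace R).
Local Notation mu := (@lebesgue_measure R).
Local Notation mem := (ss_mem X).
Local Notation N := (ss_norm X).
Implicit Types (x y f g u v : R -> R) (C d e r s t M G : R) (j k m n p : nat).
Implicit Types (eta gam sig : seq bool -> R) (xi : nat -> seq bool -> R).

Lemma mem_sum (h : nat -> R -> R) (eps : nat -> R) k0 K : (forall k, mem (h k)) ->
  mem (fun t => \sum_(k0 <= k < K) eps k * h k t).
Proof.
move=> mh; elim: K => [|K IH].
  by under eq_fun do rewrite big_geq //; exact: ss_mem0.
have [le|lt] := leqP k0 K; last by under eq_fun do rewrite big_geq //; exact: ss_mem0.
under eq_fun do rewrite big_nat_recr //=.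
exact: (ss_memD IH (ss_memZ (eps K) (mh K))).
Qed.

Lemma norm_sum (h : nat -> R -> R) (eps : nat -> R) k0 K : (forall k, mem (h k)) ->
  N (fun t => \sum_(k0 <= k < K) eps k * h k t) <= \sum_(k0 <= k < K) `|eps k| * N (h k).
Proof.
move=> mh; elim: K => [|K IH].
  by under eq_fun do rewrite big_geq //; rewrite big_geq // norm0.
have [le|lt] := leqP k0 K; last first.
  by under eq_fun do rewrite big_geq //; rewrite big_geq // norm0.
under eq_fun do rewrite big_nat_recr //=.
rewrite big_nat_recr //=; apply: le_trans (ss_normD (mem_sum _ _ _ mh) (ss_memZ (eps K) (mh K))) _.
by rewrite ss_normZ // lerD2r.
Qed.

Lemma blk0 f k : blk f (fun=> 0) k = fun=> 0.
Proof.
have -> : blk f (fun=> 0) k = blk f (fun=> 0 * 0) k by apply: eq_blk => a _; rewrite mul0r.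
by rewrite (blkZ f 0 (fun=> 0) k); apply/funext => t; rewrite mul0r.
Qed.

Definition psum f xi k0 K : R -> R := fun t => \sum_(k0 <= k < K) blk f (xi k) k t.
Definition cost f xi k0 K : R := \sum_(k0 <= k < K) N (blk f (xi k) k).

Lemma mem_psum f xi k0 K : mem f -> mem (psum f xi k0 K).
Proof.
move=> mf; have := mem_sum (fun=> 1) k0 K (fun k => mem_blk (xi k) k mf); congr mem.
by apply/funext => t; apply: eq_bigr => k _; rewrite mul1r.
Qed.

Lemma norm_psum f xi k0 K : mem f -> N (psum f xi k0 K) <= cost f xi k0 K.
Proof.
move=> mf; have := norm_sum (fun=> 1) k0 K (fun k => mem_blk (xi k) k mf).
have -> : (fun t => \sum_(k0 <= k < K) 1 * blk f (xi k) k t) = psum f xi k0 K.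
  by apply/funext => t; apply: eq_bigr => k _; rewrite mul1r.
by move=> h; apply: le_trans h _; apply: ler_sum => k _; rewrite normr1 mul1r.
Qed.

Lemma psum_cat f xi k0 K1 K2 : (k0 <= K1)%N -> (K1 <= K2)%N ->
  psum f xi k0 K2 = psum f xi k0 K1 \+ psum f xi K1 K2.
Proof. by move=> h1 h2; apply/funext => t; rewrite /psum /= (big_cat_nat h1 h2). Qed.

Lemma cost_cat f xi k0 K1 K2 : (k0 <= K1)%N -> (K1 <= K2)%N ->
  cost f xi k0 K2 = cost f xi k0 K1 + cost f xi K1 K2.
Proof. by move=> h1 h2; rewrite /cost (big_cat_nat h1 h2). Qed.

Lemma eq_psum f xi xi' k0 K : (forall k, (k0 <= k < K)%N -> xi k = xi' k) ->
  psum f xi k0 K = psum f xi' k0 K.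
Proof. by move=> h; apply/funext => t; apply: eq_big_nat => k /h ->. Qed.

Lemma eq_cost f xi xi' k0 K : (forall k, (k0 <= k < K)%N -> xi k = xi' k) ->
  cost f xi k0 K = cost f xi' k0 K.
Proof. by move=> h; apply: eq_big_nat => k /h ->. Qed.

Lemma cost_ge0 f xi k0 K : mem f -> 0 <= cost f xi k0 K.
Proof. by move=> mf; apply: sumr_ge0 => k _; apply: ss_norm_ge0; exact: mem_blk. Qed.

Hypothesis sepX : separable X.

(** The mean has second moment at most [G^2 / n.+1], so Chebyshev's inequality makes it small in
    measure; it is bounded by [G], so it is small in norm as well. *)
Lemma small_second_moment gam G e : 0 <= G -> 0 < e -> exists n0, forall n, (n0 <= n)%N ->
  forall K sig, (forall a, `|sig a| <= n.+1%:R * G) ->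
  avg (fun a => sig a ^+ 2) K <= n.+1%:R * G ^+ 2 ->
  N (blk chi01 (fun a => n.+1%:R^-1 * sig a) K) < e.
Proof.
move=> G0 e0; have [d [d0 hd]] := norm_small_measure sepX G0 e0.
pose q := G ^+ 2 / d ^+ 2 / d.
have [n0 _ hn0] := nbhs_infty_gtr q; exists n0 => n nn0 K sig sigM sig2.
have n1 : 0 < n.+1%:R :> R by rewrite ltr0n.
have nq : q < n.+1%:R by apply: hn0; exact: leqW.
apply: hd.
- exact: (measurable_blk _ _ (@measurable_chi01 R)).
- apply: (@tree_rel1 _ (fun r => `|r| <= G)) => a _; apply: aeW => t It.
  by rewrite chi01E // mulr1 normrM gtr0_norm ?invr_gt0 // mulrC ler_pdivrMr // mulrC.
- apply: le_lt_trans (chebyshev _ K d0) _; rewrite lte_fin.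
  have -> : avg (fun a => (n.+1%:R^-1 * sig a) ^+ 2) K =
      n.+1%:R^-1 ^+ 2 * avg (fun a => sig a ^+ 2) K.
    rewrite -[RHS]addr0 -(avg_const 0 K) -avg_lin; apply: eq_avg => a _.
    by rewrite exprMn addr0.
  have h : n.+1%:R^-1 ^+ 2 * avg (fun a => sig a ^+ 2) K <= G ^+ 2 / n.+1%:R.
    apply: le_trans (_ : n.+1%:R^-1 ^+ 2 * (n.+1%:R * G ^+ 2) <= _).
      by rewrite ler_pM2l // exprn_gt0 // invr_gt0.
    by rewrite expr2 mulrA mulfVK ?gt_eqF // mulrC.
  apply: le_lt_trans (_ : G ^+ 2 / n.+1%:R / d ^+ 2 < d).
    by rewrite ler_pM2r // invr_gt0 exprn_gt0.
  by rewrite mulrAC ltr_pdivrMr // [d * _]mulrC -ltr_pdivrMr.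
Qed.

(** With [g] a step function close to [f] and [gbar] its mean, [f = (f - g) + gbar + (g - gbar)]. In
    the averaged blocks the first part contributes at most [M * N (f - g)], the second gives [gbar]
    times the step function with [gbar] close to the integral of [f], and the third is small by the
    law of large numbers. *)
Lemma step_average f eta m M e k0 : mem f -> J f != 0 -> 0 <= M ->
  (forall a, `|eta a| <= M) -> (m <= k0)%N -> 0 < e ->
  exists K (eps : nat -> R) n, [/\ (k0 < K)%N,
    (forall k, 0 <= eps k), \sum_(k0 <= k < K) eps k = n.+1%:R &
    N (blk chi01 eta m \- (fun t => \sum_(k0 <= k < K)
       eps k / (n.+1%:R * J f) * blk f (fun a => eta (take m a)) k t)) < e].
Proof.
move=> mf If M0 etaM mk0 e0; set I := J f in If *.
have aI : 0 < `|I| by rewrite normr_gt0.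
have M1 : 0 < 2 * (M + 1) by lra.
(* The errors [M * e'], [M * e'] and [e'] of the three parts fit into [2 * (M + 1) * e'], which is
   [e] times [|J f|]. *)
pose e' := e * `|I| / (2 * (M + 1)).
have e'0 : 0 < e' by rewrite divr_gt0 // mulr_gt0.
have [p [gam0 [G [G0 gam0G hg]]]] := step_dense sepX mf e'0.
pose gbar := avg gam0 p.
pose gam a := gam0 a - gbar.
pose G' := G + `|gbar|.
have G'0 : 0 <= G' by rewrite addr_ge0.
have gamG a : `|gam a| <= G' by apply: le_trans (ler_normB _ _) _; rewrite lerD2r.
have gamE : avg gam p = 0.
  rewrite -[LHS](eq_avg (xi := fun a => 1 * gam0 a + - gbar)); last by move=> a _; rewrite mul1r.
  by rewrite avg_lin avg_const mul1r subrr.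
have [n0 hn0] := small_second_moment gam (mulr_ge0 M0 G'0) e'0.
have [K [eps [sig [kK [eps0 seps] S sigM sig2]]]] :=
  orthogonal_blocks M0 G'0 etaM gamG gamE mk0 n0.+1.
have hW := hn0 n0 (leqnn n0) K sig sigM sig2.
exists K, eps, n0; split => //.
  by apply: leq_trans kK; rewrite addnS ltnS leq_addr.
set g := blk chi01 gam0 p in hg.
have mg : mem g by exact: mem_step.
pose om' (a : seq bool) : R := eta (take m a).
pose u := blk (@chi01 R) (fun=> 1) p.
have n1 : n0.+1%:R != 0 :> R by rewrite pnatr_eq0.
have fE : f = (fun t => 1 * (f \- g) t + (gbar * u t + blk chi01 gam p t)).
  have E : blk chi01 gam p = (fun t => - gbar * u t + g t).
    by rewrite -blk_lin; apply: eq_blk => a _; rewrite /gam mulr1 addrC.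
  by apply/funext => t; rewrite E /=; ring.
have uE k : (k0 <= k)%N -> aeq (blk u om' k) (blk chi01 eta m).
  move=> kk; rewrite /u blk_blk.
  have := blk_chi_take om' k p.
  rewrite (eq_blk chi01 (xi' := fun a => om' (take k a) * 1)); last by move=> a _; rewrite mulr1.
  move=> h; apply: aeq_trans h _; have := blk_chi_take eta m (k - m).
  by rewrite subnKC // (leq_trans mk0 kk).
pose x := blk chi01 eta m.
pose D1 t := \sum_(k0 <= k < K) eps k * blk (f \- g) om' k t.
pose W := blk chi01 (fun a => n0.+1%:R^-1 * sig a) K.
(* The exact error: the three terms come from [gbar], from [f - g] and from the centred part. *)
pose rest := fun t => I^-1 * ((I - gbar) * x t + (- n0.+1%:R^-1 * D1 t + -1 * W t)).
have mx : mem x by exact: mem_step.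
have mW : mem W by exact: mem_step.
have mfg : mem (f \- g) by exact: memB.
have mD1 : mem D1 by apply: mem_sum => k; exact: mem_blk.
have m1 := ss_memZ (I - gbar) mx; have m2 := ss_memZ (- n0.+1%:R^-1) mD1.
have m3 := ss_memZ (-1) mW; have m23 := ss_memD m2 m3; have m123 := ss_memD m1 m23.
have mrest : mem rest by exact: (ss_memZ I^-1 m123).
have Sf : mem (fun t => \sum_(k0 <= k < K) eps k / (n0.+1%:R * I) * blk f om' k t).
  by apply: mem_sum => k; exact: mem_blk.
have ae_u : {ae mu, forall t, forall k, I01 t -> (k0 <= k)%N -> blk u om' k t = x t}.
  apply: (@ae_foralln _ _ _ mu (fun k t => I01 t -> (k0 <= k)%N -> blk u om' k t = x t)) => k.
  have [kk|kk] := leqP k0 k; last by apply: aeW.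
  by apply: ae_imp _ (uE k kk) => t ht It _; exact: ht.
rewrite (norm_aeq (memB mx Sf) mrest); last first.
  apply: ae_imp2 _ S ae_u => t St ut It; rewrite /rest /W blkZ -(St It) /=.
  transitivity (x t - (n0.+1%:R * I)^-1 * (D1 t + gbar * (n0.+1%:R * x t) +
      \sum_(k0 <= k < K) eps k * blk (blk chi01 gam p) om' k t)).
    have -> : D1 t + gbar * (n0.+1%:R * x t) +
        \sum_(k0 <= k < K) eps k * blk (blk chi01 gam p) om' k t =
        \sum_(k0 <= k < K) eps k * blk f om' k t.
      rewrite -seps mulr_suml mulr_sumr /D1 -!big_split /=.
      by apply: eq_big_nat => k /andP[kk _]; rewrite [in RHS]fE blk_linf blk_linf ut //; ring.
    by rewrite mulr_sumr; congr (_ - _); apply: eq_bigr => k _; rewrite mulrAC mulrC.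
  rewrite -/om'; set Sg := \sum_(k0 <= k < K) _.
  move: n1; move: (n0.+1%:R : R) => q q0; field.
  by rewrite If q0.
have hI : `|I - gbar| < e'.
  apply: le_lt_trans hg; have := abs_J_le sepX mfg; apply: le_trans.
  have -> : f \- g = (fun t => -1 * g t + f t) by apply/funext => t /=; rewrite mulN1r addrC.
  have ig := intbl_mem sepX mg; have ify := intbl_mem sepX mf.
  by rewrite J_lin // /g J_step mulN1r [- _ + _]addrC.
have nx : N x <= M.
  have := norm_blk_bounded (k := m) (ss_mem1 X) M0 (fun a _ => etaM a).
  by rewrite ss_norm1 mulr1.
have nD1 : N D1 <= n0.+1%:R * (M * N (f \- g)).
  apply: le_trans (norm_sum _ _ _ (fun k => mem_blk om' k mfg)) _.
  rewrite -seps mulr_suml; apply: ler_sum => k _; rewrite ger0_norm // ler_wpM2l //.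
  by apply: norm_blk_bounded => // a _; exact: etaM.
rewrite /rest (ss_normZ _ m123) normfV mulrC ltr_pdivrMr //.
apply: le_lt_trans (ss_normD m1 m23) _.
apply: le_lt_trans (lerD (lexx _) (ss_normD m2 m3)) _.
rewrite !ss_normZ // normrN1 mul1r normrN normfV normr_nat.
have h1 : n0.+1%:R^-1 * N D1 <= M * N (f \- g).
  by rewrite mulrC ler_pdivrMr ?ltr0n // mulrC.
have h2 : `|I - gbar| * N x <= M * e'.
  rewrite mulrC; apply: le_trans (_ : M * `|I - gbar| <= _); first by rewrite ler_wpM2r.
  by rewrite ler_wpM2l // ltW.
have h3 : M * N (f \- g) <= M * e' by rewrite ler_wpM2l // ltW.
have h4 : 2 * (M + 1) * e' = e * `|I| by rewrite /e' mulrC divfK // gt_eqF.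
have hW' : N W < e' := hW.
rewrite -h4; have -> : 2 * (M + 1) * e' = M * e' + (M * e' + (e' + e')) by ring.
apply: ler_ltD => //; apply: ler_ltD; first exact: le_trans h1 h3.
by apply: lt_trans hW' _; rewrite ltrDl.
Qed.

(** The weights [eps k] sum to [n.+1], so by (M) the total cost is at most [C / |J f|] times the
    norm of the approximating step function, however many levels are used. *)
Lemma one_step f C x e k0 : mem f -> J f != 0 -> 0 <= C ->
  (forall k eta, N (blk f eta k) <= C * N (blk chi01 eta k)) -> mem x -> 0 < e ->
  exists K xi, [/\ (k0 < K)%N, N (x \- psum f xi k0 K) < e &
    cost f xi k0 K <= C / `|J f| * (N x + e)].
Proof.
move=> mf If C0 hC mx e0; have e2 : 0 < e / 2 by rewrite divr_gt0.
have [m [eta [M [M0 etaM hx]]]] := step_dense sepX mx e2.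
pose k1 := maxn k0 m; have mk1 : (m <= k1)%N := leq_maxr _ _.
have kk1 : (k0 <= k1)%N := leq_maxl _ _.
have [K [eps [n [k1K eps0 seps hK]]]] := step_average mf If M0 etaM mk1 e2.
pose s := blk chi01 eta m.
pose xi k a := if (k1 <= k)%N then eps k / (n.+1%:R * J f) * eta (take m a) else 0.
have ms : mem s by exact: mem_step.
have zero k : (k < k1)%N -> blk f (xi k) k = fun=> 0.
  move=> kk; rewrite -[RHS](blk0 f k); apply: eq_blk => a _.
  by rewrite /xi leqNgt kk.
have xiE k : (k1 <= k)%N -> blk f (xi k) k =
    (fun t => eps k / (n.+1%:R * J f) * blk f (fun a => eta (take m a)) k t).
  by move=> kk; rewrite -blkZ; apply: eq_blk => a _; rewrite /xi kk.
exists K, xi; split; first exact: leq_ltn_trans kk1 k1K.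
- have -> : psum f xi k0 K = (fun t => \sum_(k1 <= k < K)
       eps k / (n.+1%:R * J f) * blk f (fun a => eta (take m a)) k t).
    rewrite (psum_cat f xi kk1 (ltnW k1K)); apply/funext => t; rewrite /psum /=.
    rewrite [X in X + _]big_nat big1 ?add0r; last by move=> k /andP[_ kk]; rewrite zero.
    by apply: eq_big_nat => k /andP[kk _]; rewrite xiE.
  set Sf := fun t => _; have mSf : mem Sf by apply: mem_sum => k; exact: mem_blk.
  have := norm_tri mx mSf ms; move: hx hK; rewrite -/s -/Sf; lra.
- rewrite (cost_cat f xi kk1 (ltnW k1K)) {1}/cost big_nat big1 ?add0r; last first.
    by move=> k /andP[_ kk]; rewrite zero // norm0.
  have n1 : 0 < n.+1%:R :> R by rewrite ltr0n.
  have aI : 0 < `|J f| by rewrite normr_gt0.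
  have bound k : (k1 <= k)%N -> N (blk f (xi k) k) <= eps k * (C * N s / (n.+1%:R * `|J f|)).
    move=> kk; rewrite xiE // ss_normZ; last exact: mem_blk.
    rewrite normrM (ger0_norm (eps0 k)) normfV normrM (ger0_norm (ltW n1)) -[leLHS]mulrA.
    rewrite ler_wpM2l // mulrC ler_wpM2r //.
    apply: le_trans (hC _ _) _; rewrite ler_wpM2l //.
    have h := blk_chi_take eta m (k - m); rewrite subnKC ?(leq_trans mk1) // in h.
    by rewrite (norm_aeq (mem_step X _ _) ms h).
  apply: le_trans (_ : \sum_(k1 <= k < K) eps k * (C * N s / (n.+1%:R * `|J f|)) <= _).
    by rewrite /cost !big_nat; apply: ler_sum => k /andP[kk _]; exact: bound.
  rewrite -mulr_suml seps.
  have -> : n.+1%:R * (C * N s / (n.+1%:R * `|J f|)) = C / `|J f| * N s.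
    by field; rewrite gt_eqF //= gt_eqF.
  rewrite ler_wpM2l ?divr_ge0 //; have := norm_triD ms mx; rewrite norm_subC //.
  move: hx; rewrite -/s; lra.
Qed.

Lemma representation f C x k0 : mem f -> J f != 0 -> 0 <= C ->
  (forall k eta, N (blk f eta k) <= C * N (blk chi01 eta k)) -> mem x ->
  exists xi, ((fun K => N (x \- psum f xi k0 K)) @ \oo --> (0 : R)) /\
    forall K, cost f xi k0 K <= 4 * (C / `|J f|) * N x.
Proof.
move=> mf If C0 hC mx; set C' := C / `|J f|.
have C'0 : 0 <= C' by rewrite divr_ge0.
(* A zero norm is treated apart because the tolerances below are fractions of [N x] and must be
   positive. *)
have [x0|x0] := eqVneq (N x) 0.
  have E K : psum f (fun _ _ => 0) k0 K = fun=> 0.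
    by apply/funext => t; rewrite /psum big1 // => k _; rewrite blk0.
  exists (fun _ _ => 0); split.
    rewrite (_ : (fun K => _) = fun=> 0); first exact: cvg_cst.
    apply/funext => K; rewrite E; transitivity (N x) => //.
    by congr N; apply/funext => t /=; rewrite subr0.
  by move=> K; rewrite x0 mulr0 /cost big1 // => k _; rewrite blk0 norm0.
have Nx : 0 < N x by rewrite lt_def x0 ss_norm_ge0.
pose del n : R := N x / 2 ^+ n.
have del0 n : 0 < del n by rewrite divr_gt0 // exprn_gt0.
have delS n : del n = 2 * del n.+1.
  by rewrite /del exprS invfM mulrCA mulVKf // pnatr_eq0.
(* A potential argument: stage [n] costs at most [C' * (del n + del n.+1) = 3 * C' * del n.+1],
   while [4 * C' * del] drops by [4 * C' * del n.+1]. *)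
pose inv n (q : nat * (nat -> seq bool -> R)) :=
  [/\ (k0 + n <= q.1)%N, N (x \- psum f q.2 k0 q.1) <= del n &
      cost f q.2 k0 q.1 + 4 * C' * del n <= 4 * C' * N x].
(* An implication, so that [choice] yields a total function; where the invariant fails the value is
   arbitrary. *)
have next (nq : nat * (nat * (nat -> seq bool -> R))) : exists q' : nat * (nat -> seq bool -> R),
    inv nq.1 nq.2 -> [/\ inv nq.1.+1 q', (nq.2.1 < q'.1)%N,
      (forall k, (k < nq.2.1)%N -> q'.2 k = nq.2.2 k) &
      cost f q'.2 k0 q'.1 + 4 * C' * del nq.1.+1 <= cost f nq.2.2 k0 nq.2.1 + 4 * C' * del nq.1].
  case: nq => n [K xi] /=.
  have [[h1 h2 h3]|ni] := pselect (inv n (K, xi)); last by exists (0%N, xi).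
  rewrite /= in h1 h2 h3.
  have mr : mem (x \- psum f xi k0 K) by apply: memB => //; exact: mem_psum.
  have [K' [xi' [KK' hr hc]]] := one_step K mf If C0 hC mr (del0 n.+1).
  pose xi2 k := if (k < K)%N then xi k else xi' k.
  have k0K : (k0 <= K)%N by apply: leq_trans h1; exact: leq_addr.
  have E1 : forall k, (k0 <= k < K)%N -> xi2 k = xi k by move=> k /andP[_ kk]; rewrite /xi2 kk.
  have E2 : forall k, (K <= k < K')%N -> xi2 k = xi' k.
    by move=> k /andP[kk _]; rewrite /xi2 ltnNge kk.
  have hcost : cost f xi2 k0 K' + 4 * C' * del n.+1 <= cost f xi k0 K + 4 * C' * del n.
    rewrite (cost_cat f xi2 k0K (ltnW KK')) (eq_cost f E1) (eq_cost f E2) -addrA lerD2l.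
    have : cost f xi' K K' <= C' * (3 * del n.+1).
      apply: le_trans hc _; rewrite -/C' ler_wpM2l //.
      by move: h2; rewrite (delS n); lra.
    have : C' * del n.+1 >= 0 by rewrite mulr_ge0 // ltW.
    rewrite (delS n); lra.
  exists (K', xi2) => _; split => //=; last by move=> k kk; rewrite /xi2 kk.
  split => /=.
  - by rewrite addnS; exact: leq_ltn_trans h1 KK'.
  - rewrite (psum_cat f xi2 k0K (ltnW KK')) (eq_psum f E1) (eq_psum f E2).
    apply: le_trans (ltW hr); rewrite le_eqVlt; apply/orP; left; apply/eqP; congr N.
    by apply/funext => t /=; ring.
  - exact: le_trans hcost h3.
have [F hF] := choice next.
pose st := fix st n := if n is n'.+1 then F (n', st n') else (k0, (fun _ _ => 0)) : nat * (nat -> seq bool -> R).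
have inv0 : inv 0%N (st 0%N).
  split => /=; first by rewrite addn0.
    rewrite (_ : x \- _ = x); first by rewrite /del expr0 divr1.
    by apply/funext => t; rewrite /psum /= big_geq // subr0.
  by rewrite /cost big_geq // add0r /del expr0 divr1.
have invst n : inv n (st n) by elim: n => [//|n IH]; have [] := hF (n, st n) IH.
have stS n := hF (n, st n) (invst n).
have Klt n : ((st n).1 < (st n.+1).1)%N by have [] := stS n.
have Kmono i j : (i <= j)%N -> ((st i).1 <= (st j).1)%N.
  by move=> /subnK <-; elim: (j - i)%N => [//|d IH]; rewrite addSn; exact: leq_trans IH (ltnW (Klt _)).
have stab i j k : (i <= j)%N -> (k < (st i).1)%N -> (st j).2 k = (st i).2 k.
  move=> /subnK <- ki; elim: (j - i)%N => [//|d IH]; rewrite addSn.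
  have [_ _ h _] := stS (d + i)%N; rewrite -IH; apply: h => /=.
  by apply: leq_trans ki _; apply: Kmono; exact: leq_addl.
have Kge n : (k0 + n <= (st n).1)%N by have [] := invst n.
(* Coefficients below the end of a stage never change later, and level [k] is settled by stage
   [k.+1]. *)
pose xi k := (st k.+1).2 k.
have kK k : (k < (st k.+1).1)%N.
  by apply: leq_trans (Kge k.+1); rewrite addnS ltnS leq_addl.
have xiE n k : (k0 <= k < (st n).1)%N -> xi k = (st n).2 k.
  move=> /andP[_ kn]; rewrite /xi; have [le|lt] := leqP n k.+1; first exact: stab.
  by apply/esym; apply: stab (ltnW lt) (kK k).
have costE n : cost f xi k0 (st n).1 = cost f (st n).2 k0 (st n).1 := eq_cost f (@xiE n).
have psumE n : psum f xi k0 (st n).1 = psum f (st n).2 k0 (st n).1 := eq_psum f (@xiE n).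
have phi i j : (i <= j)%N -> cost f xi k0 (st j).1 + 4 * C' * del j <=
    cost f xi k0 (st i).1 + 4 * C' * del i.
  rewrite !costE => /subnK <-; elim: (j - i)%N => [//|d IH]; rewrite addSn.
  by have [_ _ _ h] := stS (d + i)%N; apply: le_trans h IH.
have k0st n : (k0 <= (st n).1)%N by apply: leq_trans (Kge n); exact: leq_addr.
have Cd n : 0 <= 4 * C' * del n by rewrite !mulr_ge0 // ltW.
have Kst K : (K <= (st K).1)%N by apply: leq_trans (Kge K); exact: leq_addl.
exists xi; split; last first.
  move=> K; have [kK0|Kk0] := leqP k0 K; last first.
    by rewrite /cost big_geq ?(ltnW Kk0) // !mulr_ge0 // ltW.
  have [_ _ h] := invst K; rewrite -costE (cost_cat f xi kK0 (Kst K)) in h.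
  have := cost_ge0 xi K (st K).1 mf; have := Cd K; lra.
apply: eps_cvg_norm => [K|e e0]; first by apply: ss_norm_ge0; apply: memB => //; exact: mem_psum.
have D0 : 0 < N x * (1 + 4 * C') by rewrite mulr_gt0 // ltr_wpDr // mulr_ge0.
have [n /(_ n (leqnn n)) hn] := half_pow_small (divr_gt0 e0 D0).
exists (st n).1 => K nK.
(* For [K] inside a stage, the potential at a later stage bounds the cost from the end of stage [n]
   up to [K] by [4 * C' * del n]; hence all partial sums converge, not only those at the ends of
   stages. *)
pose j := maxn n K.
have Kj : (K <= (st j).1)%N := leq_trans (Kst K) (Kmono _ _ (leq_maxr n K)).
have := phi n j (leq_maxl n K).
rewrite (cost_cat f xi (k0st n) (leq_trans nK Kj)) (cost_cat f xi nK Kj) => hphi.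
have mP := mem_psum xi (st n).1 K mf.
have [_ h2 _] := invst n.
have mr : mem (x \- psum f xi k0 (st n).1) by apply: memB => //; exact: mem_psum.
have tri : N (x \- psum f xi k0 K) <= N (x \- psum f xi k0 (st n).1) + N (psum f xi (st n).1 K).
  have -> : x \- psum f xi k0 K = (x \- psum f xi k0 (st n).1) \+ (fun t => -1 * psum f xi (st n).1 K t).
    by rewrite (psum_cat f xi (k0st n) nK); apply/funext => t /=; ring.
  apply: le_trans (ss_normD mr (ss_memZ (-1) mP)) _.
  by rewrite ss_normZ // normrN1 mul1r.
rewrite -psumE in h2.
have h3 := norm_psum xi (st n).1 K mf.
have h4 := cost_ge0 xi K (st j).1 mf; have h5 := Cd j.
have h6 : del n * (1 + 4 * C') < e.
  move: hn; rewrite ltr_pdivlMr // /del => hn; apply: le_lt_trans hn.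
  by rewrite le_eqVlt; apply/orP; left; apply/eqP; ring.
lra.
Qed.

End Representation.

(** * From expansions in blocks back to the inequality (M) *)

Section Rescaling.
Variables (R : realType) (X : symspace R).
Local Notation mu := (@lebesgue_measure R).
Local Notation mem := (ss_mem X).
Local Notation N := (ss_norm X).
Implicit Types (x y f g u v : R -> R) (C d e r s t M G : R) (j k m n p : nat).
Implicit Types (a b : seq bool) (eta : seq bool -> R) (xi : nat -> seq bool -> R).

Definition half (i : bool) x : R -> R := fun t => x ((t + i%:R) / 2).

(** Blows the dyadic interval with address [a] up to the unit interval, so that the integral of
    [rescale a x] is the mean of [x] over that interval. *)
Definition rescale a x : R -> R := foldl (fun y i => half i y) x a.

Lemma measurable_contraction (i : bool) :
  measurable_fun setT (fun t : R => (t + i%:R) / 2).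
Proof.
have m1 : measurable_fun setT (fun t : R => t + i%:R).
  by apply: measurable_funD => //; exact: measurable_cst.
by apply: (@measurable_funM _ _ R _ _ (cst 2^-1) m1); exact: measurable_cst.
Qed.

Lemma measurable_half i x : measurable_fun I01 x -> measurable_fun I01 (half i x).
Proof.
move=> mx; have s : (fun t => (t + i%:R) / 2) @` I01 `<=` (I01 : set R).
  move=> _ [t /= + <-]; rewrite /I01 /= !in_itv /= => /andP[? ?].
  by case: i => /=; apply/andP; split; lra.
have m2 := measurable_funTS (D := I01) (measurable_contraction i).
exact: (measurable_comp (@measurable_I01 R) s mx m2).
Qed.

(** Compressing [half i x] back into its half gives the restriction of [x] to that half, so the
    dilation lemmas apply. *)
Lemma half_bound i x : mem x -> mem (half i x) /\ N (half i x) <= 2 * N x.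
Proof.
move=> mx; have mh := measurable_half i (ss_meas mx); case: i mh => mh.
- have mV := measurable_V1 mh.
  have le : {ae mu, forall t, I01 t -> `|V1 (half true x) t| <= `|x t|}.
    apply: aeW => t _; rewrite /V1; case: ifP => _; last by rewrite normr0.
    by rewrite /half /= (_ : (2 * t - 1 + 1) / 2 = t) //; field.
  have [m1 n1] := V1_dilation mh (mem_dom mx mV le); split => //.
  by apply: le_trans n1 _; rewrite ler_pM2l //; exact: norm_dom mx mV le.
- have mV := measurable_V0 mh.
  have le : {ae mu, forall t, I01 t -> `|V0 (half false x) t| <= `|x t|}.
    apply: aeW => t _; rewrite /V0; case: ifP => _; last by rewrite normr0.
    by rewrite /half /= (_ : (2 * t + 0) / 2 = t) //; field.
  have [m1 n1] := V0_dilation mh (mem_dom mx mV le); split => //.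
  by apply: le_trans n1 _; rewrite ler_pM2l //; exact: norm_dom mx mV le.
Qed.

Lemma rescale_bound a x : mem x ->
  mem (rescale a x) /\ N (rescale a x) <= 2 ^+ size a * N x.
Proof.
elim: a x => [|i a IH] x mx /=; first by rewrite expr0 mul1r.
have [mh nh] := half_bound i mx; have [m1 n1] := IH _ mh; split => //.
apply: le_trans n1 _; rewrite exprSr -mulrA ler_wpM2l // exprn_ge0 //.
Qed.

Lemma rescaleD a c x y : rescale a (fun t => c * x t + y t) =
  (fun t => c * rescale a x t + rescale a y t).
Proof. by elim: a x y => [//|i a IH] x y /=; rewrite -IH. Qed.

Lemma aeq_half i x y : aeq x y -> aeq (half i x) (half i y).
Proof.
move=> [Z [mZ Z0 sZ]].
pose Z' := [set t | Z ((t + i%:R) / 2)].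
have mZ' : measurable Z'.
  by have := measurable_contraction i measurableT mZ; rewrite setTI.
exists Z'; split => //.
  have := mu_affine i%:R mZ'.
  have -> : (fun t => 2 * t - i%:R) @^-1` Z' = Z.
    by apply/seteqP; split => t; rewrite /Z' /= (_ : (2 * t - i%:R + i%:R) / 2 = t) //; field.
  have Zm : mu Z = 0%E := Z0.
  rewrite Zm => /esym/eqP; rewrite mule_eq0 => /orP[|/eqP //].
  by rewrite eqe invr_eq0 pnatr_eq0.
move=> t nt; apply: sZ => /= h; apply: nt => It; apply: h.
move: It; rewrite /I01 /= !in_itv /= => /andP[? ?].
by case: i {Z' mZ'} => /=; apply/andP; split; lra.
Qed.

Lemma half_join i u v : aeq (half i (join u v)) (if i then v else u).
Proof.
apply: ae_imp2 _ (ae_ne 0) (ae_ne 1) => t t0 t1.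
rewrite /I01 /= in_itv /= => /andP[h0 h1].
have {}t0 : 0 < t by rewrite lt_def t0.
have {}t1 : t < 1 by rewrite lt_def eq_sym t1.
case: i; rewrite /half /=.
  rewrite joinr; last by apply/andP; split; lra.
  by congr v; field.
rewrite joinl; last by apply/andP; split; lra.
by congr u; field.
Qed.

Lemma aeq_rescale a x y : aeq x y -> aeq (rescale a x) (rescale a y).
Proof. by elim: a x y => [//|i a IH] x y h /=; apply: IH; exact: aeq_half. Qed.

Lemma rescale_blk a f eta k :
  aeq (rescale a (blk f eta (size a + k))) (blk f (fun b => eta (a ++ b)) k).
Proof.
elim: a eta => [|i a IH] eta; first exact: aeq_refl.
rewrite /= addSn blkS; apply: aeq_trans (aeq_rescale a (half_join i _ _)) _.
by case: i; exact: IH.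
Qed.

Hypothesis sepX : separable X.

Lemma J_aeq x y : mem x -> mem y -> aeq x y -> J x = J y.
Proof.
move=> mx my xy; have ix := intbl_mem sepX mx; have iy := intbl_mem sepX my.
have := abs_J_le sepX (memB mx my).
have -> : N (x \- y) = 0.
  by apply/(ss_norm_eq0 (memB mx my)); apply: ae_imp _ xy => t h It /=; rewrite h // subrr.
have -> : x \- y = (fun t => -1 * y t + x t) by apply/funext => t /=; rewrite mulN1r addrC.
by rewrite J_lin // mulN1r normr_le0 addrC subr_eq0 => /eqP.
Qed.

Lemma J_rescale_blk a f eta k : mem f ->
  J (rescale a (blk f eta (size a + k))) = avg (fun b => eta (a ++ b)) k * J f.
Proof.
move=> mf; rewrite -(J_blk _ _ (intbl_mem sepX mf)); apply: J_aeq.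
- by have [] := rescale_bound a (mem_blk eta (size a + k) mf).
- exact: mem_blk.
- exact: rescale_blk.
Qed.

Lemma J_rescale_psum_geq a f xi K : (K <= size a)%N -> J (rescale a (psum f xi (size a) K)) = 0.
Proof.
move=> Ka; have -> : psum f xi (size a) K = fun=> 0.
  by apply/funext => t; rewrite /psum big_geq.
have -> : rescale a (fun=> 0) = (fun=> 0 : R) by elim: a {Ka} => [//|i a IH] /=.
by rewrite /J /Rintegral integral0.
Qed.

Lemma J_rescale_psum a f xi K : mem f ->
  J (rescale a (psum f xi (size a) K)) =
  \sum_(size a <= k < K) avg (fun b => xi k (a ++ b)) (k - size a) * J f.
Proof.
move=> mf; elim: K => [|K IH].
  by rewrite J_rescale_psum_geq // big_geq.
have [le|lt] := leqP (size a) K; last first.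
  by rewrite J_rescale_psum_geq // big_geq.
rewrite big_nat_recr //= -IH.
have -> : psum f xi (size a) K.+1 = (fun t => 1 * psum f xi (size a) K t + blk f (xi K) K t).
  by apply/funext => t; rewrite /psum big_nat_recr //= mul1r.
have [mp _] := rescale_bound a (mem_psum xi (size a) K mf).
have [mb _] := rescale_bound a (mem_blk (xi K) K mf).
rewrite rescaleD (J_lin _ (intbl_mem sepX mp) (intbl_mem sepX mb)) mul1r.
by congr (_ + _); rewrite -J_rescale_blk // subnKC.
Qed.

(** The expansion is taken with [k0 = m], so that all its blocks refine the level of the step
    function. A finite partial sum suffices: its means over the finitely many intervals of level [m]
    miss those of [x] by at most [2^m] times the norm of the residual, which tends to 0. *)
Lemma representation_step_multiplicator f C : mem f -> J f != 0 -> 0 <= C ->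
  (forall k0 x, mem x -> exists xi, ((fun K => N (x \- psum f xi k0 K)) @ \oo --> (0 : R)) /\
    forall K, cost X f xi k0 K <= C * N x) ->
  step_multiplicator X f.
Proof.
move=> mf If C0 rep; exists (`|J f| * C); split; first by rewrite mulr_ge0.
move=> m eta; pose x := blk chi01 eta m; have mx : mem x by exact: mem_step.
have [xi [cv hc]] := rep m x mx.
apply/ler_addgt0Pr => e e0.
have D0 : 0 < 2 ^+ m * (N f + 1) by rewrite mulr_gt0 ?exprn_gt0 // ltr_wpDl // ss_norm_ge0.
have [K /(_ K (leqnn K)) hK] := cvg_norm_eps cv (divr_gt0 e0 D0).
(* The coefficients of [E_m y_k]; replacing a block by the one with these coefficients does not
   increase its norm, by [norm_avg]. *)
pose ek k a : R := avg (fun b => xi k (a ++ b)) (k - m).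
pose ez a : R := \sum_(m <= k < K) ek k a.
have close a : size a = m -> `|eta a - J f * ez a| <= 2 ^+ m * N (x \- psum f xi m K).
  move=> am; have mP := mem_psum xi m K mf.
  have mr := memB mx mP; have [m1 n1] := rescale_bound a mr.
  rewrite am in n1; apply: le_trans n1; apply: le_trans (abs_J_le sepX m1).
  have -> : x \- psum f xi m K = (fun t => -1 * psum f xi m K t + x t).
    by apply/funext => t /=; rewrite mulN1r addrC.
  have [mx1 _] := rescale_bound a mx; have [mp1 _] := rescale_bound a mP.
  rewrite rescaleD (J_lin _ (intbl_mem sepX mp1) (intbl_mem sepX mx1)).
  have := J_rescale_psum a xi K mf; rewrite am => ->.
  have := J_rescale_blk a eta 0 (ss_mem1 X); rewrite addn0 am /= cats0 J_chi mulr1 => ->.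
  by rewrite -mulr_suml mulN1r [- _ + _]addrC [_ * J f]mulrC.
have nez : N (blk f ez m) <= C * N x.
  apply: le_trans (hc K).
  have -> : blk f ez m = (fun t => \sum_(m <= k < K) 1 * blk f (ek k) m t).
    rewrite /ez; elim: (K) => [|K' IH].
      rewrite (@eq_blk _ _ _ (fun=> 0)); last by move=> a _; rewrite big_geq.
      by rewrite blk0; apply/funext => t; rewrite big_geq.
    have [le|lt] := leqP m K'; last first.
      rewrite (@eq_blk _ _ _ (fun=> 0)); last by move=> a _; rewrite big_geq.
      by rewrite blk0; apply/funext => t; rewrite big_geq.
    rewrite (@eq_blk _ _ _ (fun a => 1 * (\sum_(m <= k < K') ek k a) + ek K' a)); last first.
      by move=> a _; rewrite big_nat_recr //= mul1r.
    by rewrite blk_lin IH; apply/funext => t; rewrite big_nat_recr //= !mul1r.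
  apply: le_trans (norm_sum _ _ _ (fun k => mem_blk (ek k) m mf)) _.
  rewrite /cost !big_nat; apply: ler_sum => k /andP[mk _]; rewrite normr1 mul1r.
  by have := norm_avg (xi k) m (k - m) mf; rewrite subnKC.
(* The first part is controlled by the cost of the expansion; the second has coefficients that are
   uniformly small by [close]. *)
have -> : blk f eta m = (fun t => J f * blk f ez m t + blk f (fun a => eta a - J f * ez a) m t).
  by rewrite -blk_lin; apply: eq_blk => a _; rewrite addrC subrK.
have mez := mem_blk ez m mf; have mdf := mem_blk (fun a => eta a - J f * ez a) m mf.
apply: le_trans (ss_normD (ss_memZ (J f) mez) mdf) _; rewrite ss_normZ //.
apply: lerD; first by rewrite -mulrA ler_wpM2l.
have h0 : 0 <= N (x \- psum f xi m K) by apply: ss_norm_ge0; apply: memB => //; exact: mem_psum.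
have p0 : 0 <= 2 ^+ m * N (x \- psum f xi m K) by rewrite mulr_ge0 // exprn_ge0.
apply: le_trans (norm_blk_bounded mf p0 close) _.
rewrite ltr_pdivlMr // in hK; apply: le_trans (ltW hK).
rewrite -mulrA mulrCA ler_wpM2l // ler_wpM2l ?exprn_ge0 //; lra.
Qed.

End Rescaling.

(** * Assembly of the two implications, with tuple-indexed coefficients translated to words and
    back *)

Theorem theorem2 (R : realType) (X : symspace R) (f : R -> R) :
  separable X -> ss_mem X f ->
  (\int[@lebesgue_measure R]_(t in I01) (f t)%:E != 0)%E ->
  (multiplicator X f <->
   exists C : R, 0 < C /\ forall k0 : nat, abs_repr_system X f k0 C).
Proof.
move=> sepX mf int0.
have If : J f != 0.
  (* [J f] is the [fine] part of the integral, and [fine] sends infinite values to 0; integrability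
     of [f] excludes these. *)
  apply: contra int0 => /eqP Jf0.
  have mI : (R.-ocitv.-measurable).-sigma.-measurable (I01 : set R) := @measurable_I01 R.
  have fin := integrable_fin_num mI (intbl_mem sepX mf).
  by rewrite -(fineK fin) -[fine _]/(J f) Jf0.
split.
- move=> /(multiplicator_step mf) [C [C0 hC]].
  have C'0 : 0 <= 4 * (C / `|J f|) by rewrite mulr_ge0 // divr_ge0.
  (* Adding 1 makes the constant positive even if [C = 0]. *)
  exists (4 * (C / `|J f|) + 1); split => [|k0 x mx]; first by rewrite ltr_wpDl.
  have [xi [cv hc]] := representation sepX k0 mf If C0 hC mx.
  pose xi' k (a : k.-tuple bool) := xi k a.
  have bE k : block f xi' k = blk f (xi k) k by exact: blockE.
  exists xi'; split.
    have -> : partial_sum f xi' k0 = psum f xi k0 => //.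
    by apply/funext => K; apply/funext => t; apply: eq_bigr => k _; rewrite bE.
  move=> K; under eq_bigr do rewrite bE.
  apply: le_trans (hc K) _; rewrite ler_wpM2r ?lerDl //; exact: ss_norm_ge0.
- move=> [C [C0 rep]]; apply: step_multiplicator_multiplicator => //.
  apply: (representation_step_multiplicator sepX mf If (ltW C0)) => k0 x mx.
  have [xi' [cv hc]] := rep k0 x mx.
  (* Coefficients of words of the wrong length are set to 0. *)
  pose xi k (a : seq bool) : R := oapp (xi' k) 0 (insub a).
  have bE k : block f xi' k = blk f (xi k) k by apply: blockE => a; rewrite /xi valK.
  have pE : partial_sum f xi' k0 = psum f xi k0.
    by apply/funext => K; apply/funext => t; apply: eq_bigr => k _; rewrite bE.
  rewrite pE in cv; exists xi; split => // K.
  by apply: le_trans (hc K); rewrite /cost; under [leRHS]eq_bigr do rewrite bE.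
Qed.
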